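(* Consider one of the two models (Model 1: generalized Ehrenfest; Model 2: Glauber type with $d$ states) described in the context, with state spaces $E_n\subseteq E$, generators $A_n$ and Hamiltonian $H$, and suppose that the rate conditions for that model listed in the context are satisfied. Suppose there exist measures $\nu_n\in\mathcal{P}(E_n)\subseteq\mathcal{P}(E)$ that are invariant for the dynamics generated by $A_n$, and that the measures $\nu_n$ satisfy the large deviation principle on $E$ with good rate function $I_0$. Let $\mathbf{F}(x):=H_p(x,0)$, where $H_p(x,p)$ is the vector of partial derivatives of $H$ in the second coordinate. Then $I_0$ is non-increasing along any solution of $\dot x(t)=\mathbf{F}(x(t))$ in $E$; that is, for any such solution $x:[0,\infty)\to E$, the map $t\mapsto I_0(x(t))$ is non-increasing.
   Context: Fix $d\ge1$. Model 1 (generalized Ehrenfest). $E=E_1=[-1,1]^d$, $E_n=E_{1,n}=\{x\in E_1:x_i\in\{-1,-1+\frac2n,\dots,1\}\ \forall i\}$. Given $r_{n,+}^i,r_{n,-}^i:E_{1,n}\to[0,\infty)$, $$A_nf(x)=\sum_{i=1}^d\Big\{n\tfrac{1-x_i}{2}r_{n,+}^i(x)\big[f(x+\tfrac2n e_i)-f(x)\big]+n\tfrac{1+x_i}{2}r_{n,-}^i(x)\big[f(x-\tfrac2n e_i)-f(x)\big]\Big\}.$$ Rate conditions: there are continuous $v_\pm^i:E_1\to[0,\infty)$ with $\lim_n\sup_{x\in E_{1,n}}\sum_{i}\big(|\frac{1-x_i}{2}r_{n,+}^i(x)-v_+^i(x)|+|\frac{1+x_i}{2}r_{n,-}^i(x)-v_-^i(x)|\big)=0$,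 and for every $i$: $v_+^i\equiv0$, or [$v_+^i(x)>0$ if $x_i\ne1$; and for every $z\in E_1$ with $z_i=1$, $v_+^i(z)=0$ and on some neighbourhood of $z$ one has $v_+^i(x)=v_{+,z,\dagger}^i(x_i)v_{+,z,\ddagger}^i(x)$ with $v_{+,z,\dagger}^i$ decreasing and $v_{+,z,\ddagger}^i$ continuous with $v_{+,z,\ddagger}^i(z)\ne0$]; and $v_-^i\equiv0$, or [$v_-^i(x)>0$ if $x_i\ne-1$; and for every $z\in E_1$ with $z_i=-1$, $v_-^i(z)=0$ and on some neighbourhood of $z$ one has $v_-^i(x)=v_{-,z,\dagger}^i(x_i)v_{-,z,\ddagger}^i(x)$ with $v_{-,z,\dagger}^i$ increasing and $v_{-,z,\ddagger}^i$ continuous with $v_{-,z,\ddagger}^i(z)\ne0$]. Hamiltonian: $H(x,p)=\sum_{i}\big(v_+^i(x)[e^{2p_i}-1]+v_-^i(x)[e^{-2p_i}-1]\big)$. Model 2 (Glauber type with $d$ states). $E=E_2=\mathcal{P}(\{1,\dots,d\})=\{\mu\in\mathbb{R}^d:\mu_i\ge0,\sum_i\mu_i=1\}$, $E_n=E_{2,n}=\{\frac1n\sum_{i=1}^n\delta_{x_i}:x_i\in\{1,\dots,d\}\}$. Given $r_n:\{1,\dots,d\}^2\times E_{2,n}\to[0,\infty)$, $$A_nf(\mu)=n\sum_{a,b}\mu(a)r_n(a,b,\mu)\big[f(\mu-n^{-1}\delta_a+n^{-1}\delta_b)-f(\mu)\big].$$ Rate conditions: there is a continuous $v:\{1,\dots,d\}^2\times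 E_2\to[0,\infty)$ with $\lim_n\sup_{\mu\in E_{2,n}}|\mu(a)r_n(a,b,\mu)-v(a,b,\mu)|=0$ for all $a,b$, and for each $a,b$, $v(a,b,\cdot)\equiv0$ or [$v(a,b,\mu)>0$ whenever $\mu(a)>0$; and for every $\nu$ with $\nu(a)=0$, on some neighbourhood of $\nu$ one has $v(a,b,\mu)=v_{\nu,\dagger}(a,b,\mu(a))v_{\nu,\ddagger}(a,b,\mu)$ with $v_{\nu,\dagger}$ increasing in the third coordinate and $v_{\nu,\ddagger}(a,b,\cdot)$ continuous with $v_{\nu,\ddagger}(a,b,\nu)\ne0$]. Hamiltonian: $H(\mu,p)=\sum_{a,b}v(a,b,\mu)[e^{p_b-p_a}-1]$. Terms of $A_n$ with vanishing prefactor are zero. A sequence of probability measures $\nu_n$ on $E$ satisfies the large deviation principle with rate function $I_0:E\to[0,\infty]$ if $I_0$ is lower semi-continuous, $\limsup_n\frac1n\log\nu_n(G)\le-\inf_GI_0$ for all closed $G$, and $\liminf_n\frac1n\log\nu_n(U)\ge-\inf_UI_0$ for all open $U$; it is good if all sets $\{I_0\le a\}$, $a\ge0$, are compact. Solutions of the differential equation are not assumed to be unique. *)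

(* Defs.v *)
From HB Require Import structures.
From mathcomp Require Import all_boot all_order all_algebra.
From mathcomp Require Import all_classical all_reals all_analysis.

Set Implicit Arguments.
Unset Strict Implicit.
Unset Printing Implicit Defensive.

Import Order.TTheory GRing.Theory Num.Theory.
Import numFieldNormedType.Exports.

Local Open Scope classical_set_scope.
Local Open Scope ring_scope.

Notation borel T := (g_sigma_algebraType (@open T)).

Section LDP.
Context {R : realType} {T : ptopologicalType}.

(* Large deviation principle on the subspace E of T.  The closed (open) subsets
   of E are the traces on E of the closed (open) subsets of T; in [subspace E]
   the points outside E are isolated, so lower semi-continuity is only required
   along E.  Here [lne 0 = -oo] and [ereal_inf set0 = +oo]. *)
Definition LDP (E : set T) (nu : nat -> probability (borel T) R)
    (I0 : T -> \bar R) : Prop :=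
  [/\ forall x, E x -> (0 <= I0 x)%E,
      lower_semicontinuous (I0 : subspace E -> \bar R),
      forall G : set T, closed G ->
        (limn_esup (fun n => (n%:R^-1)%:E * lne (nu n (E `&` G)))
          <= - ereal_inf [set I0 x | x in E `&` G])%E
    & forall U : set T, open U ->
        (- ereal_inf [set I0 x | x in E `&` U]
          <= limn_einf (fun n => (n%:R^-1)%:E * lne (nu n (E `&` U))))%E].

Definition good_rate (E : set T) (I0 : T -> \bar R) : Prop :=
  forall a : R, 0 <= a -> compact (E `&` [set x | (I0 x <= a%:E)%E]).

End LDP.

Section Invariance.
Context {R : realType} {T : ptopologicalType}.

(* The Markov semigroup exp (t A).  It is only used at points of a finite state
   space En on which A restricts to an operator on functions on En, where the
   exponential series converges. *)
Definition semigroup (A : (T -> R) -> T -> R) (t : R) (f : T -> R) (x : T) : R :=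
  limn (series (fun k => t ^+ k / k`!%:R * iter k A f x)).

Definition invariant_measure (En : set T) (A : (T -> R) -> T -> R)
    (nu : probability (borel T) R) : Prop :=
  nu En = 1%E /\
  forall (t : R) (f : T -> R), 0 <= t ->
    (\int[nu]_(x in En) (semigroup A t f x)%:E = \int[nu]_(x in En) (f x)%:E)%E.

End Invariance.

Section Models.
Context {R : realType} {d : nat}.
Implicit Types (x p z mu : 'rV[R]_d) (i a b : 'I_d).

Definition vanishes_on (E : set 'rV[R]_d) (v : 'rV[R]_d -> R) : Prop :=
  forall x, E x -> v x = 0.

(* Near z, relatively to E, v is the product of a function of the i-th
   coordinate that satisfies [monotone] and a continuous function that does not
   vanish at z. *)
Definition factorizes_near (E : set 'rV[R]_d) (monotone : (R -> R) -> Prop) i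
    (v : 'rV[R]_d -> R) z : Prop :=
  exists (U : set 'rV[R]_d) (vdag : R -> R) (vddag : 'rV[R]_d -> R),
    [/\ nbhs z U,
        monotone vdag,
        {within E `&` U, continuous vddag},
        vddag z != 0
      & forall x, E x -> U x -> v x = vdag (x ord0 i) * vddag x].

Definition cube : set 'rV[R]_d := [set x | forall i, -1 <= x ord0 i <= 1].

Definition cube_grid (n : nat) : set 'rV[R]_d :=
  [set x | cube x /\
    forall i, exists2 k : nat, (k <= n)%N & x ord0 i = -1 + k%:R * (2 / n%:R)].

(* The values of rp n i and rm n i outside cube_grid n are irrelevant at points
   of cube_grid n: the jumps that would leave the grid have weight 0. *)
Definition ehrenfest_generator (rp rm : nat -> 'I_d -> 'rV[R]_d -> R) (n : nat)
    (f : 'rV[R]_d -> R) x : R :=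
  \sum_(i < d)
    (n%:R * ((1 - x ord0 i) / 2) * rp n i x *
       (f (x + (2 / n%:R) *: delta_mx ord0 i) - f x) +
     n%:R * ((1 + x ord0 i) / 2) * rm n i x *
       (f (x - (2 / n%:R) *: delta_mx ord0 i) - f x)).

Definition ehrenfest_hamiltonian (vp vm : 'I_d -> 'rV[R]_d -> R) x p : R :=
  \sum_(i < d) (vp i x * (expR (2 * p ord0 i) - 1) +
                vm i x * (expR (- (2 * p ord0 i)) - 1)).

Record ehrenfest_rates (rp rm : nat -> 'I_d -> 'rV[R]_d -> R)
    (vp vm : 'I_d -> 'rV[R]_d -> R) : Prop := {
  ehrenfest_r_ge0 : forall n i x, (0 < n)%N -> cube_grid n x ->
    0 <= rp n i x /\ 0 <= rm n i x;
  ehrenfest_v_ge0 : forall i x, cube x -> 0 <= vp i x /\ 0 <= vm i x;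
  ehrenfest_v_continuous : forall i,
    {within cube, continuous (vp i)} /\ {within cube, continuous (vm i)};
  ehrenfest_cvg :
    ereal_sup [set (\sum_(i < d)
        (`|(1 - x ord0 i) / 2 * rp n i x - vp i x| +
         `|(1 + x ord0 i) / 2 * rm n i x - vm i x|))%:E | x in cube_grid n]
      @[n --> \oo] --> 0%E;
  ehrenfest_vp : forall i, vanishes_on cube (vp i) \/
    ((forall x, cube x -> x ord0 i != 1 -> 0 < vp i x) /\
     forall z, cube z -> z ord0 i = 1 ->
       vp i z = 0 /\
       factorizes_near cube
         (fun g : R -> R => {in `[-1, 1] &, nonincreasing_fun g}) i (vp i) z);
  ehrenfest_vm : forall i, vanishes_on cube (vm i) \/
    ((forall x, cube x -> x ord0 i != -1 -> 0 < vm i x) /\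
     forall z, cube z -> z ord0 i = -1 ->
       vm i z = 0 /\
       factorizes_near cube
         (fun g : R -> R => {in `[-1, 1] &, nondecreasing_fun g}) i (vm i) z) }.

Definition simplex : set 'rV[R]_d :=
  [set mu | (forall i, 0 <= mu ord0 i) /\ \sum_(i < d) mu ord0 i = 1].

Definition empirical (n : nat) : set 'rV[R]_d :=
  [set mu | exists s : 'I_n -> 'I_d,
    mu = n%:R^-1 *: \sum_(k < n) delta_mx ord0 (s k)].

Definition glauber_generator (r : nat -> 'I_d -> 'I_d -> 'rV[R]_d -> R) (n : nat)
    (f : 'rV[R]_d -> R) mu : R :=
  n%:R * \sum_(a < d) \sum_(b < d)
    mu ord0 a * r n a b mu *
      (f (mu - n%:R^-1 *: delta_mx ord0 a + n%:R^-1 *: delta_mx ord0 b) - f mu).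

Definition glauber_hamiltonian (v : 'I_d -> 'I_d -> 'rV[R]_d -> R) mu p : R :=
  \sum_(a < d) \sum_(b < d) v a b mu * (expR (p ord0 b - p ord0 a) - 1).

Record glauber_rates (r : nat -> 'I_d -> 'I_d -> 'rV[R]_d -> R)
    (v : 'I_d -> 'I_d -> 'rV[R]_d -> R) : Prop := {
  glauber_r_ge0 : forall n a b mu, (0 < n)%N -> empirical n mu ->
    0 <= r n a b mu;
  glauber_v_ge0 : forall a b mu, simplex mu -> 0 <= v a b mu;
  glauber_v_continuous : forall a b, {within simplex, continuous (v a b)};
  glauber_cvg : forall a b,
    ereal_sup [set `|mu ord0 a * r n a b mu - v a b mu|%:E | mu in empirical n]
      @[n --> \oo] --> 0%E;
  glauber_v : forall a b, vanishes_on simplex (v a b) \/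
    ((forall mu, simplex mu -> 0 < mu ord0 a -> 0 < v a b mu) /\
     forall z, simplex z -> z ord0 a = 0 ->
       factorizes_near simplex
         (fun g : R -> R => {in `[0, 1] &, nondecreasing_fun g}) a (v a b) z) }.

(* [is_model E En A H]: the state spaces En n inside E, the generators A n and
   the Hamiltonian H are those of one of the two models. *)
Inductive is_model : set 'rV[R]_d -> (nat -> set 'rV[R]_d) ->
    (nat -> ('rV[R]_d -> R) -> 'rV[R]_d -> R) ->
    ('rV[R]_d -> 'rV[R]_d -> R) -> Prop :=
| Ehrenfest rp rm vp vm of ehrenfest_rates rp rm vp vm :
    is_model cube cube_grid (ehrenfest_generator rp rm)
      (ehrenfest_hamiltonian vp vm)
| Glauber r v of glauber_rates r v :
    is_model simplex empirical (glauber_generator r) (glauber_hamiltonian v).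

(* x |-> H_p (x, 0) *)
Definition drift (H : 'rV[R]_d -> 'rV[R]_d -> R) x : 'rV[R]_d :=
  \row_(i < d) 'D_(delta_mx ord0 i) (H x) 0.

(* Solutions on [0, +oo[, with values in E, of x' = F (x); the derivative at 0 is
   one-sided.  The values of x at negative times are irrelevant. *)
Definition solution (E : set 'rV[R]_d) (F : 'rV[R]_d -> 'rV[R]_d)
    (x : R -> 'rV[R]_d) : Prop :=
  [/\ forall t : R, 0 <= t -> E (x t),
      forall t : R, 0 < t -> is_derive t 1 x (F (x t))
    & h^-1 *: (x h - x 0) @[h --> 0^'+] --> F (x 0)].

End Models.

(* Main.v *)
(* Invariance of nu_n under the generator A_n makes it invariant under the
   uniformized kernel 1 + A_n / (n Lambda), whose N-step transition probability
   between two points of E_n is bounded below by a multinomial count of the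
   orderings of a prescribed set of jumps.  With nearly constant rates v_k near
   z and Stirling's formula, displacing z by tau * sum_k w_k e_k has
   probability at least exp (- n tau (L (w, v (z)) + o (1))), where
   L (w, v) = sum_k (w_k ln (w_k / v_k) - w_k + v_k), and the large deviation
   bounds turn this into
     I0 (z + tau * sum_k w_k e_k) <= I0 (z) + tau (L (w, v (z)) + o (1)).
   As L (v, v) = 0, this controls the upper right Dini derivative of I0 along a
   solution by 0, and lower semi-continuity does the rest.

   A jump k of the displacement must satisfy v_k (z) > 0.  In the Ehrenfest
   model the increment of a solution can always be written with such jumps.  In
   the Glauber model it cannot when a coordinate starts from 0; the solution is
   then shifted by z' - z, where z' is close to z, I0 (z') is close to I0 (z),
   and z' charges every state that can be reached from the support of z.  The
   monotone factor of the rates bounds the cost of following the shifted path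
   with the rates of the original one, and z' tends to z. *)
Require Import Defs.
From mathcomp Require Import all_boot all_order all_algebra.
From mathcomp Require Import all_classical all_reals all_analysis.
From mathcomp Require Import ring lra.
Import Order.TTheory GRing.Theory Num.Theory.
Import numFieldNormedType.Exports.
Set Implicit Arguments.
Unset Strict Implicit.
Unset Printing Implicit Defensive.
Local Open Scope classical_set_scope.
Local Open Scope ring_scope.

(** The large deviation principle concerns the invariant measures alone, and solutions need not be
    unique, so no path-space principle is used: the dynamics only provides a lower bound for one
    short displacement at a time. Of the semigroup only the first-order term matters, which says
    that A_n f has integral 0; every power of the uniformized kernel then preserves nu_n, and N can
    be fitted to the prescribed jumps, staying put included. That I0 is merely lower semi-continuous
    shapes the rest. The time step on which the cost is small depends on the current point, hence a
    supremum argument replaces a partition of the time interval. Closeness of z' to z says nothing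
    about I0 (z'), hence z' must itself be reached from z by jumps of small total cost. Finally the
    time step is fixed before z': the shifted path costs at most eta per unit of time whatever z'
    is, and only then does z' tend to z. *)

Section RealEstimates.
Context {R : realType}.
Implicit Types (a b eta : R) (n : nat).

Lemma ln_le_subr1 a : 0 < a -> ln a <= a - 1.
Proof.
by move=> a0; rewrite -{1}[a](subrKC 1); apply: le_ln1Dx; lra.
Qed.

(** The upper half of Stirling's formula, up to a polynomial factor. The induction step amounts to
    (n+2) ln ((n+2)/(n+1)) >= 1, which is [ln_le_subr1] at (n+1)/(n+2). *)
Lemma ln_fact_le n : (0 < n)%N ->
  ln (n`!%:R : R) <= 1 + n.+1%:R * ln n%:R - n%:R.
Proof.
case: n => // n _; elim: n => [|n IH]; first by rewrite ln1; lra.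
rewrite factS natrM lnM ?posrE ?ltr0n ?fact_gt0//.
have h : ln (n.+1%:R / n.+2%:R : R) <= n.+1%:R / n.+2%:R - 1.
  by apply: ln_le_subr1; rewrite divr_gt0 ?ltr0n.
rewrite ln_div ?posrE ?ltr0n// in h.
have h2 : (1 : R) <= n.+2%:R * (ln n.+2%:R - ln n.+1%:R).
  rewrite -ler_pdivrMl ?ltr0n// mulr1 -[X in _ <= X]opprB lerNr.
  apply: le_trans h _; rewrite le_eqVlt; apply/orP; left; apply/eqP.
  by field; rewrite -natrD pnatr_eq0.
rewrite -![n.+3%:R]natr1 -[n.+2%:R in X in _ + _ - X]natr1.
move: IH h2; set u := ln _; set w := ln n.+2%:R; set y := ln n.+1%:R.
lra.
Qed.

(** One term of the exponential series. It stands in for the lower half of Stirling's formula when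
    N! is bounded below. *)
Lemma pow_div_fact_le_expR a n : 0 <= a -> a ^+ n / n`!%:R <= expR a.
Proof.
move=> a0.
have nd : {homo series (exp_coeff a) : p q / (p <= q)%N >-> p <= q}.
  by apply/nondecreasing_seqP => k; rewrite -subr_ge0 seriesSB exp_coeff_ge0.
apply: le_trans (nondecreasing_cvgn_le nd (is_cvg_series_exp_coeff a) n.+1).
rewrite /series/= big_nat_recr//= lerDr sumr_ge0// => i _; exact: exp_coeff_ge0.
Qed.

(** Exponential growth rate of an unnormalized Poisson weight at a count close to n b. Rounding the
    count costs a bounded amount and Stirling's formula a logarithmic one; n eta absorbs both. *)
Lemma pow_div_fact_ge a b eta : 0 < a -> 0 <= b -> 0 < eta ->
  \forall n \near \oo,
    expR (n%:R * (b * ln (a / b) + b - eta)) <=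
    (n%:R * a) ^+ Num.trunc (n%:R * b) / (Num.trunc (n%:R * b))`!%:R.
Proof.
move=> a0; rewrite le_eqVlt => /predU1P[<- eta0|b0 eta0].
  exists 0%N => // n _; rewrite mulr0 truncn0 expr0 fact0 divr1 mul0r addr0 sub0r.
  by rewrite mulrN -expR0 ler_expR oppr_le0 mulr_ge0// ltW.
(* The bounded errors: replacing the count by n b costs |ln (a / b)| and 1, [ln_fact_le] contributes
   another 1, and the last term comes from ln (n b) <= n eta / 2 + |ln (2 b / eta)|. The other half
   of n eta pays for [C]. *)
pose C : R := `|ln (a / b)| + 2 + `|ln (2 * b / eta)|.
exists (maxn (Num.trunc (1 / b)).+1 (Num.trunc (2 * C / eta)).+1) => // n /=.
rewrite geq_max => /andP[n1 n2].
have nb : 1 < n%:R * b.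
  rewrite -ltr_pdivrMr//; apply: lt_le_trans (_ : (Num.trunc (1 / b)).+1%:R <= _).
    exact: truncnS_gt.
  by rewrite ler_nat.
have nC : C <= n%:R * (eta / 2).
  rewrite -ler_pdivrMr ?divr_gt0//.
  have -> : C / (eta / 2) = 2 * C / eta by field; rewrite gt_eqF.
  apply: le_trans (_ : (Num.trunc (2 * C / eta)).+1%:R <= _).
    by rewrite ltW// truncnS_gt.
  by rewrite ler_nat.
have n0 : (0 < n)%N by case: n {nC n1 n2} nb => //; rewrite mul0r; lra.
have nR0 : (0 : R) < n%:R by rewrite ltr0n.
set j := Num.trunc _.
have /andP[j1 j2] : j%:R <= n%:R * b < j.+1%:R.
  by apply: truncn_itv; rewrite ltW// (lt_trans _ nb).
have j0 : (0 < j)%N by rewrite lt0n; apply: contraTneq j2 => ->; rewrite -leNgt ltW.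
have jR0 : (0 : R) < j%:R by rewrite ltr0n.
rewrite -[leRHS]lnK ?posrE; last first.
  by rewrite divr_gt0 ?exprn_gt0 ?mulr_gt0// ltr0n fact_gt0.
rewrite ler_expR [X in _ <= X]ln_div ?posrE ?exprn_gt0 ?mulr_gt0 ?ltr0n ?fact_gt0//.
rewrite lnXn ?mulr_gt0// -[_ *+ j]mulr_natl.
have hf := ln_fact_le j0.
have hlj : ln (j%:R : R) <= ln n%:R + ln b.
  by rewrite -lnM ?posrE// ler_ln ?posrE ?mulr_gt0.
have hnb : ln n%:R + ln b <= n%:R * (eta / 2) + `|ln (2 * b / eta)|.
  have -> : ln n%:R + ln b = ln (n%:R * (eta / 2)) + ln (2 * b / eta).
    rewrite -lnM ?posrE// -lnM ?posrE ?(mulr_gt0, divr_gt0, invr_gt0)//.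
    by congr ln; field; rewrite gt_eqF.
  apply: lerD; last exact: ler_norm.
  apply: le_trans (ln_le_subr1 _) _; first by rewrite mulr_gt0// divr_gt0.
  by rewrite gerBl.
have lnna : ln (n%:R * a) = ln n%:R + ln a by rewrite lnM ?posrE.
have lnab : ln (a / b) = ln a - ln b by rewrite ln_div ?posrE.
have hj : j%:R * ln (a / b) >= n%:R * b * ln (a / b) - `|ln (a / b)|.
  rewrite lerBlDr -lerBlDl -mulrBl; apply: le_trans (ler_norm _) _.
  rewrite normrM ler_piMl// ger0_norm ?subr_ge0//.
  by move: j2; rewrite -natr1; lra.
have hj2 : j%:R * ln j%:R <= j%:R * (ln n%:R + ln b) by rewrite ler_pM2l.
rewrite -natr1 in j2 hf.
have lnb : `|ln (a/b)| + 2 + `|ln (2 * b / eta)| <= n%:R * (eta / 2) by [].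
rewrite lnna.
move: hf hlj hnb hj hj2 j1 j2 lnb; rewrite lnab.
set u := ln j%:R; set p := ln n%:R; set q := ln _`!%:R; set la := ln a; set lb := ln b.
set ab := `|la - lb|; set be := `|_|; move: (n%:R : R) => nn; move: (j%:R : R) => jj.
lra.
Qed.
End RealEstimates.

Lemma finite_set_bounded {R : realType} (T : choiceType) (S : set T) (g : T -> R) :
  finite_set S -> exists2 M, 0 <= M & forall x, S x -> `|g x| <= M.
Proof.
move=> /finite_seqP[s ->]; exists (\sum_(y <- s) `|g y|) => [|x /= xs].
  by rewrite sumr_ge0.
by rewrite (big_rem x)//= lerDl sumr_ge0.
Qed.

(** * Invariant measures with finite support *)

Section FiniteIntegrals.
Context {R : realType} {T : ptopologicalType}.
Hypothesis hT : hausdorff_space T.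
Variables (nu : probability (borel T) R) (S : set T).
Hypothesis finS : finite_set S.

Lemma finite_borel_measurable (B : set T) :
  finite_set B -> measurable (B : set (borel T)).
Proof.
move=> finB; rewrite -[B]setCK; apply: measurableC; apply: sub_sigma_algebra.
apply: closed_openC; apply: compact_closed => //; exact: finite_compact.
Qed.

Lemma finite_Rintegrable (g : T -> R) : nu.-integrable S (EFin \o g).
Proof.
apply: measurable_bounded_integrable; [exact: finite_borel_measurable| | |].
- by rewrite (le_lt_trans (probability_le1 _ _)) ?ltry//; exact: finite_borel_measurable.
- move=> _ B _; apply: finite_borel_measurable.
  by apply: sub_finite_set finS => x [].
- have [M _ gM] := finite_set_bounded g finS.
  exists M; split; first exact: num_real.
  by move=> K MK x Sx /=; exact: le_trans (gM x Sx) (ltW MK).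
Qed.

(** The k-th term of the series is at most t ^+ k * M * C ^+ k / k!, and t ^+ k <= t ^+ 2 for k >= 2
    because t <= 1. The bound on [A] only refers to values on [S], so it can be iterated. *)
Lemma semigroup_taylor1 (A : (T -> R) -> T -> R) (C M t : R) (f : T -> R) :
  0 <= C -> 0 <= t <= 1 ->
  (forall g K, (forall x, S x -> `|g x| <= K) ->
     forall x, S x -> `|A g x| <= C * K) ->
  (forall x, S x -> `|f x| <= M) ->
  forall x, S x ->
    `|semigroup A t f x - (f x + t * A f x)| <= t ^+ 2 * (M * expR C).
Proof.
move=> C0 /andP[t0 t1] bA bf x Sx.
have M0 : 0 <= M by apply: le_trans (bf _ Sx).
have bAk k y : S y -> `|iter k A f y| <= C ^+ k * M.
  elim: k y => [|k IH] y Sy; first by rewrite mul1r bf.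
  by rewrite iterS exprS -mulrA; apply: bA.
rewrite /semigroup; set u := (fun k => _).
have bu k : `|u k| <= t ^+ k * (M * exp_coeff C k).
  rewrite /u normrM ger0_norm ?divr_ge0 ?exprn_ge0//.
  have -> : t ^+ k * (M * exp_coeff C k) = t ^+ k / k`!%:R * (C ^+ k * M).
    by rewrite /exp_coeff/=; ring.
  by rewrite ler_wpM2l ?bAk// divr_ge0 ?exprn_ge0.
have cu : cvgn (series u).
  apply: normed_cvg; apply: (@series_le_cvg _ _ (M *: exp_coeff C)) => [k|k|k|].
  - exact: normr_ge0.
  - by rewrite /GRing.scale/= mulr_ge0// exp_coeff_ge0.
  - apply: le_trans (bu k) _; rewrite ler_piMl ?exprn_ile1//.
    by rewrite mulr_ge0// exp_coeff_ge0.
  - exact/is_cvg_seriesZ/is_cvg_series_exp_coeff.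
rewrite distrC.
have cl := @closed_closed_ball_ R R^o (f x + t * A f x) (t ^+ 2 * (M * expR C)).
apply: (closed_cvg _ cl _ _ cu).
exists 2%N => // n /= n2; rewrite /closed_ball_/=.
have -> : f x + t * A f x = series u 2.
  rewrite /series/= big_mkord !big_ord_recl big_ord0 /u /= fact0 divr1 expr0 mul1r.
  by rewrite expr1 divr1 addr0.
have split2 (w : R^nat) : series w n = series w 2 + \sum_(2 <= i < n) w i.
  by rewrite /series/= (big_cat_nat _ n2).
rewrite distrC split2 addrAC subrr add0r.
apply: le_trans (ler_norm_sum _ _ _) _.
have : \sum_(2 <= i < n) `|u i| <= \sum_(2 <= i < n) t ^+ 2 * (M * exp_coeff C i).
  rewrite big_nat_cond [leRHS]big_nat_cond.
  apply: ler_sum => i; rewrite andbT => /andP[i2 _]; apply: le_trans (bu i) _.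
  by rewrite ler_wpM2r ?ler_wiXn2l// mulr_ge0// exp_coeff_ge0.
move/le_trans; apply; rewrite -mulr_sumr -mulr_sumr ler_wpM2l ?exprn_ge0// ler_wpM2l//.
have nd : {homo series (exp_coeff C) : a b / (a <= b)%N >-> a <= b}.
  apply/nondecreasing_seqP => k; rewrite -subr_ge0 seriesSB.
  exact: exp_coeff_ge0.
apply: le_trans (nondecreasing_cvgn_le nd (is_cvg_series_exp_coeff C) n).
by rewrite split2 lerDr sumr_ge0// => i _; exact: exp_coeff_ge0.
Qed.

(** Invariance cancels the zeroth-order term of the semigroup, so t times the integral of [A f] is
    of order t ^+ 2; dividing by t and letting t tend to 0 concludes. *)
Lemma invariant_Rintegral_eq0 (A : (T -> R) -> T -> R) (C : R) (f : T -> R) :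
  0 <= C ->
  (forall g K, (forall x, S x -> `|g x| <= K) ->
     forall x, S x -> `|A g x| <= C * K) ->
  invariant_measure S A nu ->
  (\int[nu]_(x in S) A f x = 0)%R.
Proof.
move=> C0 bA [nuS inv].
have mS := finite_borel_measurable finS.
have [M M0 bf] := finite_set_bounded f finS.
set I := (X in X = 0).
suff bI t : 0 < t <= 1 -> `|I| <= t * (M * expR C).
  apply/eqP; rewrite -normr_le0; apply/ler_addgt0Pr => e e0; rewrite add0r.
  pose K := M * expR C + 1.
  have K0 : 0 < K by rewrite ltr_pwDr// mulr_ge0// expR_ge0.
  have [eK|Ke] := leP (e / K) 1.
    apply: le_trans (bI (e / K) _) _; first by rewrite divr_gt0.
    by rewrite -mulrA ler_piMr ?(ltW e0)// ler_pdivrMl// mulr1 lerDl.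
  apply: le_trans (bI 1 _) _; first by rewrite ltr01 lexx.
  rewrite mul1r; move: Ke; rewrite ltr_pdivlMr// mul1r => /ltW; apply: le_trans.
  by rewrite lerDl.
move=> /andP[t0 t1].
have h := @semigroup_taylor1 A C M t f C0 _ bA bf.
have E : (\int[nu]_(x in S) semigroup A t f x = \int[nu]_(x in S) f x)%R.
  by rewrite /Rintegral inv// ltW.
have E2 : t * I = - (\int[nu]_(x in S) (semigroup A t f x - (f x + t * A f x)))%R.
  rewrite RintegralB ?RintegralD ?RintegralZl//; try exact: finite_Rintegrable.
  by rewrite E -/I; ring.
rewrite -(ler_pM2l t0) -{1}(ger0_norm (ltW t0)) -normrM E2 normrN.
apply: le_trans (le_normr_Rintegral mS (finite_Rintegrable _)) _.
have -> : t * (t * (M * expR C)) = (\int[nu]_(x in S) (t ^+ 2 * (M * expR C)))%R.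
  rewrite Rintegral_cst//; move: nuS => /= ->; rewrite mulr1; ring.
apply: le_Rintegral => //; try exact: finite_Rintegrable.
by move=> x Sx; apply: h => //; rewrite (ltW t0).
Qed.
End FiniteIntegrals.

(** * Multinomial lower bound for iterated jump kernels *)

Section Counting.
Context {R : realType} {V : zmodType} {K : finType}.
Variables (S : set V) (p : K -> V -> R) (s : K -> V).
Hypothesis p_ge0 : forall k x, S x -> 0 <= p k x.
Hypothesis p_jump : forall k x, S x -> 0 < p k x -> S (x + s k).

Definition jump_sum (f : V -> R) x := \sum_k p k x * f (x + s k).

Lemma iter_jump_sum_ge0 (f : V -> R) N x :
  (forall y, S y -> 0 <= f y) -> S x -> 0 <= iter N jump_sum f x.
Proof.
move=> f0; elim: N x => [|N IH] x Sx; first exact: f0.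
rewrite iterS; apply: sumr_ge0 => k _.
have := p_ge0 k Sx; rewrite le_eqVlt => /predU1P[<-|pk]; first by rewrite mul0r.
by rewrite mulr_ge0 ?(ltW pk)// IH//; exact: p_jump.
Qed.

(* N! / prod_k (j k)! is the number of orderings of the jumps, and all of them
   stay in G. *)
Lemma iter_jump_sum_ge (G : set V) (m : K -> R) (f : V -> R) N (j : K -> nat) x :
  (forall y, S y -> 0 <= f y) ->
  (forall k, 0 <= m k) ->
  (\sum_k j k)%N = N -> S x ->
  (forall k y, (0 < j k)%N -> S y -> G y -> m k <= p k y) ->
  (forall i : K -> nat, (forall k, (i k <= j k)%N) -> G (x + \sum_k s k *+ i k)) ->
  (S (x + \sum_k s k *+ j k) -> 1 <= f (x + \sum_k s k *+ j k)) ->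
  N`!%:R * \prod_k m k ^+ j k <= iter N jump_sum f x * \prod_k (j k)`!%:R.
Proof.
move=> f0 m0; elim: N j x => [|N IH] j x jN Sx mp Gj fj.
  have j0 k : j k = 0%N.
    by move/eqP: jN; rewrite sum_nat_eq0 => /forallP/(_ k) /eqP.
  rewrite (eq_bigr (fun=> 1)) => [|k _]; last by rewrite j0.
  rewrite [X in _ <= _ * X](eq_bigr (fun=> 1)) => [|k _]; last by rewrite j0.
  rewrite big1// fact0 !mulr1 /=; move: fj; rewrite big1 ?addr0 => [|k _].
    exact.
  by rewrite j0.
pose j' k l := (j l - (l == k))%N.
have j'E k : (0 < j k)%N -> forall l, j l = (j' k l + (l == k))%N.
  by move=> jk l; rewrite subnK//; case: eqP => // ->.
have prodE k (F : K -> nat -> R) : (0 < j k)%N ->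
    \prod_l F l (j l) = F k (j k) * \prod_(l | l != k) F l (j' k l).
  move=> jk; rewrite (bigD1 k)//=; congr (_ * _); apply: eq_bigr => l lk.
  by rewrite /j' (negbTE lk) subn0.
have step k : (0 < j k)%N ->
    (j k)%:R * (N`!%:R * \prod_l m l ^+ j l) <=
    p k x * iter N jump_sum f (x + s k) * \prod_l (j l)`!%:R.
  move=> jk; have Gx : G x.
    by have := Gj (fun=> 0%N) (fun=> isT); rewrite big1 ?addr0.
  have mk : m k <= p k x by apply: mp.
  have := p_ge0 k Sx; rewrite le_eqVlt => /predU1P[p0|pk].
    have mk0 : m k = 0 by apply/eqP; rewrite eq_le m0 andbT p0.
    rewrite -p0 !mul0r (prodE k (fun l i => m l ^+ i))//.
    by rewrite mk0 expr0n gtn_eqF// !(mul0r, mulr0).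
  have : N`!%:R * \prod_l m l ^+ j' k l <=
      iter N jump_sum f (x + s k) * \prod_l (j' k l)`!%:R.
    apply: IH.
    - apply/succn_inj; rewrite -jN -addn1.
      rewrite (eq_bigr _ (fun l _ => j'E k jk l)) big_split/=; congr (_ + _)%N.
      by rewrite (bigD1 k)//= eqxx big1// => l /negbTE ->.
    - exact: p_jump.
    - by move=> l y jl; apply: mp; rewrite (leq_trans jl)// leq_subr.
    - move=> i ij; have -> : x + s k + \sum_l s l *+ i l =
          x + \sum_l s l *+ (i l + (l == k)).
        rewrite -addrA; congr (_ + _); rewrite [RHS](eq_bigr (fun l => s l *+ i l +
          s l *+ (l == k))) => [|l _]; last by rewrite mulrnDr.
        rewrite big_split/= addrC; congr (_ + _).
        by rewrite (bigD1 k)//= eqxx big1 ?addr0// => l /negbTE ->.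
      by apply: Gj => l; rewrite (j'E _ jk) leq_add2r.
    - move: fj; set y := _ + _ => fj; set y' := _ + _; suff <- : y = y' by [].
      rewrite /y /y' -addrA; congr (_ + _); rewrite [LHS](eq_bigr (fun l => s l *+ j' k l +
          s l *+ (l == k))) => [|l _]; last by rewrite -mulrnDr -j'E.
      rewrite big_split/= addrC; congr (_ + _).
      by rewrite (bigD1 k)//= eqxx big1 ?addr0// => l /negbTE ->.
  rewrite (prodE k (fun l i => m l ^+ i))// (prodE k (fun _ i => i`!%:R))//.
  rewrite [X in _ * X <= _](bigD1 k)//= [X in _ <= _ * X](bigD1 k)//=.
  have jk1 : j k = (j' k k).+1 by rewrite (j'E _ jk) eqxx addn1.
  rewrite jk1 factS natrM exprS; set J := _.+1%:R.
  set a := iter _ _ _ _; set b := \prod_(_ | _) _ ^+ _; set c := (\prod_(_ | _) _).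
  move=> h.
  have -> : J * (N`!%:R * (m k * m k ^+ j' k k * b)) =
    m k * J * (N`!%:R * (m k ^+ j' k k * b)) by ring.
  have -> : p k x * a * (J * (j' k k)`!%:R * c) =
    p k x * J * (a * ((j' k k)`!%:R * c)) by ring.
  apply: ler_pM => //; first by rewrite mulr_ge0.
    rewrite mulr_ge0// mulr_ge0 ?exprn_ge0// prodr_ge0// => l _.
    exact: exprn_ge0.
  by rewrite ler_wpM2r.
(* Conditioning on the first jump: N.+1 is the sum of the counts j k, so the factorial splits into
   one term j k * N! for each type of first jump. *)
rewrite iterS factS natrM -jN natr_sum -mulrA mulr_suml /jump_sum mulr_suml.
apply: ler_sum => k _; have [|jk] := leqP (j k) 0; last exact: step.
rewrite leqn0 => /eqP ->; rewrite mul0r.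
have := p_ge0 k Sx; rewrite le_eqVlt => /predU1P[<-|pk]; first by rewrite !mul0r.
rewrite mulr_ge0 ?prodr_ge0// mulr_ge0 ?(ltW pk)//.
by apply: iter_jump_sum_ge0 => //; exact: p_jump.
Qed.
End Counting.

(** * Jump models and their uniformization *)

(* The common form of the two models: on En n, jumps e k / n at rate
   n * rho n k, where rho n k approximates v k. *)
Record jump_model (R : realType) (d : nat) (K : finType) (E : set 'rV[R]_d)
    (En : nat -> set 'rV[R]_d) (e : K -> 'rV[R]_d)
    (rho : nat -> K -> 'rV[R]_d -> R) (v : K -> 'rV[R]_d -> R) : Prop := {
  jump_finite : forall n, (0 < n)%N -> finite_set (En n);
  jump_sub : forall n, (0 < n)%N -> En n `<=` E;
  jump_rho_ge0 : forall n k x, (0 < n)%N -> En n x -> 0 <= rho n k x;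
  jump_step : forall n k x, (0 < n)%N -> En n x -> 0 < rho n k x ->
    En n (x + n%:R^-1 *: e k);
  jump_v_ge0 : forall k x, E x -> 0 <= v k x;
  jump_compact : compact E;
  jump_v_continuous : forall k, {within E, continuous (v k)};
  jump_cvg : forall k (eps : R), 0 < eps ->
    \forall n \near \oo, forall x, En n x -> `|rho n k x - v k x| <= eps }.

Definition jump_generator (R : realType) (d : nat) (K : finType)
    (e : K -> 'rV[R]_d) (rho : nat -> K -> 'rV[R]_d -> R) (n : nat)
    (f : 'rV[R]_d -> R) (x : 'rV[R]_d) : R :=
  n%:R * \sum_k rho n k x * (f (x + n%:R^-1 *: e k) - f x).

Lemma sum_option (K : finType) (V : nmodType) (F : option K -> V) :
  \sum_k F k = F None + \sum_k F (Some k).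
Proof.
rewrite (bigD1 None)//=; congr (_ + _).
rewrite [LHS](reindex_omap Some id)//= => [|[]//].
by apply: eq_bigl => k; rewrite eqxx.
Qed.

Section Uniformization.
Context {R : realType} {d : nat} {K : finType}.
Variables (n : nat) (S : set 'rV[R]_d) (e : K -> 'rV[R]_d).
Variables (rho : nat -> K -> 'rV[R]_d -> R) (Lam : R).
Variable nu : probability (borel 'rV[R]_d) R.
Hypothesis n_gt0 : (0 < n)%N.
Hypothesis finS : finite_set S.
Hypothesis rho_ge0 : forall k x, S x -> 0 <= rho n k x.
Hypothesis rho_step : forall k x, S x -> 0 < rho n k x ->
  S (x + n%:R^-1 *: e k).
Hypothesis Lam_ge0 : 0 <= Lam.
Hypothesis rho_sum : forall x, S x -> \sum_k rho n k x <= Lam.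
Hypothesis nu_inv : invariant_measure S (jump_generator e rho n) nu.

(* The chain may also stay put, which makes the total jump rate constant. *)
Definition stay_rate (k : option K) (x : 'rV[R]_d) : R :=
  if k is Some k then rho n k x else Lam - \sum_k rho n k x.

Definition stay_step (k : option K) : 'rV[R]_d :=
  if k is Some k then n%:R^-1 *: e k else 0.

Let T := jump_sum stay_rate stay_step.

Lemma stay_rate_ge0 k x : S x -> 0 <= stay_rate k x.
Proof. by case: k => [k|] Sx /=; rewrite ?rho_ge0// subr_ge0 rho_sum. Qed.

Lemma stay_rate_step k x : S x -> 0 < stay_rate k x -> S (x + stay_step k).
Proof. by case: k => [k|] Sx /=; [exact: rho_step|rewrite addr0]. Qed.

(** [T] is [Lam] times the uniformized kernel; leaving it unnormalized avoids a division by [Lam]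
    and is the origin of the powers [Lam ^+ N] below. *)
Lemma jump_sum_generator f x :
  T f x = n%:R^-1 * jump_generator e rho n f x + Lam * f x.
Proof.
rewrite /T /jump_sum sum_option /= addr0 /jump_generator.
rewrite mulKf ?pnatr_eq0 -?lt0n//.
under [X in _ = X + _]eq_bigr do rewrite mulrBr.
by rewrite sumrB -mulr_suml; ring.
Qed.

Lemma Rintegral_iter_jump_sum f N :
  (\int[nu]_(x in S) iter N T f x = Lam ^+ N * \int[nu]_(x in S) f x)%R.
Proof.
have int g : nu.-integrable S (EFin \o g).
  by apply: finite_Rintegrable => //; exact: norm_hausdorff.
have mS : measurable (S : set (borel 'rV[R]_d)).
  by apply: finite_borel_measurable => //; exact: norm_hausdorff.
elim: N f => [|N IH] f; first by rewrite mul1r.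
rewrite iterSr IH exprSr -mulrA; congr (_ * _).
rewrite (_ : (fun x => _) = fun x =>
  n%:R^-1 * jump_generator e rho n f x + Lam * f x); last first.
  by apply/funext => x; exact: jump_sum_generator.
have gen0 : (\int[nu]_(x in S) jump_generator e rho n f x = 0)%R.
  apply: (invariant_Rintegral_eq0 _ finS (C := n%:R * (Lam * 2))) => //.
  - by rewrite !mulr_ge0.
  move=> g B gB x Sx; rewrite /jump_generator normrM ger0_norm// -!mulrA ler_wpM2l//.
  apply: le_trans (ler_norm_sum _ _ _) _.
  have B0 : 0 <= B by apply: le_trans (gB _ Sx).
  apply: le_trans (_ : \sum_k rho n k x * (2 * B) <= _); last first.
    by rewrite -mulr_suml ler_wpM2r ?mulr_ge0// rho_sum.
  apply: ler_sum => k _; rewrite normrM ger0_norm ?rho_ge0//.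
  have := rho_ge0 k Sx; rewrite le_eqVlt => /predU1P[<-|rk]; first by rewrite !mul0r.
  rewrite ler_wpM2l ?(ltW rk)//; apply: le_trans (ler_normB _ _) _.
  rewrite mulr_natl mulr2n lerD//; apply: gB => //; exact: rho_step.
move: (jump_generator e rho n f) gen0 => g gen0.
rewrite RintegralD ?RintegralZl ?gen0//; try exact: int.
by rewrite mulr0 add0r.
Qed.

(** The counting bound for the indicator of the part of [B] in [S], integrated against [nu]. [G]
    contains every intermediate position of a path started in [A], so [m] bounds the rates met on
    the way; starting points outside [A] contribute a nonnegative amount. *)
Lemma measure_jumps_ge (A B G : set 'rV[R]_d) (m : option K -> R) (j : option K -> nat) :
  (forall k, 0 <= m k) ->
  (forall k y, (0 < j k)%N -> S y -> G y -> m k <= stay_rate k y) ->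
  (forall x (i : option K -> nat), S x -> A x -> (forall k, (i k <= j k)%N) ->
    G (x + \sum_k stay_step k *+ i k)) ->
  (forall x, S x -> A x -> B (x + \sum_k stay_step k *+ j k)) ->
  (\sum_k j k)`!%:R * \prod_k (m k ^+ j k / (j k)`!%:R) * fine (nu (S `&` A))
    <= Lam ^+ (\sum_k j k)%N * fine (nu (S `&` B)).
Proof.
move=> m0 mG AG AB.
have int g : nu.-integrable S (EFin \o g).
  by apply: finite_Rintegrable => //; exact: norm_hausdorff.
have mfin C : finite_set C -> measurable (C : set (borel 'rV[R]_d)).
  by apply: finite_borel_measurable => //; exact: norm_hausdorff.
have finI C : finite_set (S `&` C) by apply: sub_finite_set finS => x [].
have measE C : fine (nu (S `&` C)) = (\int[nu]_(x in S) \1_(S `&` C) x)%R.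
  rewrite /Rintegral integral_indic; [|exact: mfin|exact: mfin].
  by rewrite setIAC setIid.
rewrite !measE -Rintegral_iter_jump_sum -RintegralZl; [|exact: mfin|exact: int].
set N := (\sum_k j k)%N; set c := _ * _.
have c0 : 0 <= c.
  by rewrite /c mulr_ge0// prodr_ge0// => k _; rewrite divr_ge0// exprn_ge0.
have f0 y : S y -> 0 <= (\1_(S `&` B) y : R) by rewrite indicE.
apply: le_Rintegral; [exact: mfin|exact: int|exact: int|move=> x Sx].
rewrite indicE; have [/set_mem [_ Ax]|_] := boolP (x \in S `&` A); last first.
  rewrite mulr0; apply: iter_jump_sum_ge0 Sx => //.
    by move=> k y; exact: stay_rate_ge0.
  by move=> k y; exact: stay_rate_step.
rewrite mulr1.
have h := @iter_jump_sum_ge R _ _ S stay_rate stay_step stay_rate_ge0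
  stay_rate_step G m _ N j x f0 m0 erefl Sx mG.
rewrite /c prodf_div mulrA ler_pdivrMr; last first.
  by apply: prodr_gt0 => k _; rewrite ltr0n fact_gt0.
apply: h => [i ij|Sy]; first exact: AG.
by rewrite indicE mem_set//; split=> //; exact: AB.
Qed.
End Uniformization.

(** * Displacements along a line *)

Section StraightLine.
Context {R : realType} {d : nat} {K : finType}.
Variables (E : set 'rV[R]_d) (En : nat -> set 'rV[R]_d) (e : K -> 'rV[R]_d).
Variables (rho : nat -> K -> 'rV[R]_d -> R) (v : K -> 'rV[R]_d -> R).
Hypothesis model : jump_model E En e rho v.
Variable nu : nat -> probability (borel 'rV[R]_d) R.
Hypothesis nu_inv : forall n, (0 < n)%N ->
  invariant_measure (En n) (jump_generator e rho n) (nu n).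

Lemma jump_rate_bound : exists C : R, forall k, \forall n \near \oo,
  forall x, En n x -> rho n k x <= C.
Proof.
suff [C vC] : exists C : R, forall k x, E x -> v k x <= C.
  exists (C + 1) => k; near=> n => x nx.
  have n0 : (0 < n)%N by near: n; exact: nbhs_infty_gt.
  apply: le_trans (_ : v k x + 1 <= _); last first.
    by rewrite lerD2r; apply: vC; exact: (jump_sub model n0 nx).
  rewrite -lerBlDl; apply: le_trans (ler_norm _) _.
  by move: x nx; near: n; exact: (jump_cvg model).
have h k : exists C : R, forall x, E x -> v k x <= C.
  have /compact_bounded : compact [set v k x | x in E].
    by apply: continuous_compact; [exact: (jump_v_continuous model)|exact: (jump_compact model)].
  move=> [C [_ /(_ (C + 1))]]; rewrite ltrDl => /(_ ltr01) h.
  exists (C + 1) => x Ex; apply: le_trans (ler_norm _) _.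
  by apply: (h (v k x)); exists x.
have [C hC] := choice h.
exists (\sum_k `|C k|) => k x Ex; apply: le_trans (hC k x Ex) _.
apply: le_trans (ler_norm _) _.
by rewrite (bigD1 k)//= lerDl sumr_ge0.
Unshelve. all: by end_near.
Qed.

(** [m] and [M] bracket the rates near z, with a margin [kappa] that absorbs the difference between
    [rho n] and [v]. The upper bound [M] matters because it bounds the probability of staying put
    from below. *)
Lemma measure_line_ge (z : 'rV[R]_d) (w m M : K -> R) (delta tau kappa eps eta : R) :
  (forall k, 0 <= w k) -> (forall k, 0 < m k) -> 0 < tau -> 0 < kappa ->
  tau * (\sum_k w k * `|e k|) < delta ->
  (forall k x, E x -> `|z - x| < delta ->
     v k x + kappa <= M k /\ (0 < w k -> m k + kappa <= v k x)) ->
  0 < eps -> 0 < eta ->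
  exists2 r : R, 0 < r & \forall n \near \oo,
    expR (- (n%:R * (tau * (\sum_k (w k * ln (w k / m k) - w k + M k)) + eta))) *
      fine (nu n (En n `&` ball z r)) <=
    fine (nu n (En n `&` [set x | `|z + tau *: (\sum_k w k *: e k) - x| <= eps])).
Proof.
move=> w0 m0 tau0 kappa0 wdelta vmM eps0 eta0.
have [C rhoC] := jump_rate_bound.
(* The terms |C| make [Lam] dominate the total jump rate; the rest makes Lam - sum M positive. *)
pose Lam := 1 + \sum_k (`|C| + `|M k|).
pose m' (k : option K) := if k is Some k then m k else Lam - \sum_k M k.
(* Staying put gets an intensity equal to its rate bound: it adds no logarithmic term, and its
   linear term Lam - sum M produces the [M k] of the cost. *)
pose w' (k : option K) := if k is Some k then w k else Lam - \sum_k M k.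
have LamM : 0 < Lam - \sum_k M k.
  rewrite /Lam -addrA -sumrB ltr_pwDl// sumr_ge0// => k _.
  by rewrite -addrA addr_ge0// subr_ge0 ler_norm.
have Lam0 : 0 < Lam.
  by rewrite ltr_pwDl// sumr_ge0// => k _; rewrite addr_ge0.
have m'0 k : 0 < m' k by case: k.
have w'0 k : 0 <= w' k by case: k => [k|]//=; exact: ltW.
pose L := \sum_k w k * `|e k|.
(* The offset of the starting point may use half of [eps] at the landing, and a path of length at
   most tau * L has to stay within [delta] of z. *)
pose r := Num.min (eps / 2) (delta - tau * L).
have r0 : 0 < r by rewrite lt_min divr_gt0// subr_gt0.
exists r => //.
pose eta' := eta / #|{: option K}|%:R.
have cK : (0 : R) < #|{: option K}|%:R by rewrite ltr0n; apply/card_gt0P; exists None.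
have eta'0 : 0 < eta' by rewrite divr_gt0.
near=> n.
have n0 : (0 < n)%N by near: n; exact: nbhs_infty_gt.
have nR0 : (0 : R) < n%:R by rewrite ltr0n.
have rho_le k x : En n x -> rho n k x <= C.
  by move: k x; near: n; apply: filter_forall => k; exact: rhoC.
have rho_v k x : En n x -> `|rho n k x - v k x| <= kappa.
  by move: k x; near: n; apply: filter_forall => k; exact: (jump_cvg model).
have pow k : expR (n%:R * (tau * w' k * ln (tau * m' k / (tau * w' k)) + tau * w' k - eta')) <=
    (n%:R * (tau * m' k)) ^+ Num.trunc (n%:R * (tau * w' k)) /
    (Num.trunc (n%:R * (tau * w' k)))`!%:R.
  move: k; near: n; apply: filter_forall => k; apply: pow_div_fact_ge => //.
  - by rewrite mulr_gt0.
  - by rewrite mulr_ge0// ltW.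
pose j k := Num.trunc (n%:R * (tau * w' k)).
have jP k : (j k)%:R <= n%:R * (tau * w' k) < (j k).+1%:R.
  by apply: truncn_itv; rewrite !mulr_ge0// ltW.
have nle : n%:R^-1 * (\sum_k `|e k|) <= eps / 2.
  rewrite ler_pdivrMl// -ler_pdivrMr ?divr_gt0//.
  by near: n; exact: nbhs_infty_ger.
have rho_in k x : En n x -> `|z - x| < delta ->
    rho n k x <= M k /\ (0 < w k -> m k <= rho n k x).
  move=> nx xd; have [vM vm] := vmM k x (jump_sub model n0 nx) xd.
  have := rho_v k x nx; rewrite ler_norml => /andP[h1 h2]; split; first by lra.
  by move=> /vm; lra.
have ballP x : ball z r x -> `|z - x| < r by rewrite -ball_normE.
have sstep (i : option K -> nat) :
    \sum_k stay_step n e k *+ i k = \sum_k ((i (Some k))%:R / n%:R) *: e k.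
  rewrite sum_option/= mul0rn add0r; apply: eq_bigr => k _.
  by rewrite -scaler_nat scalerA.
have key : (\sum_k j k)`!%:R * \prod_k (m' k ^+ j k / (j k)`!%:R) * fine (nu n (En n `&` ball z r))
    <= Lam ^+ (\sum_k j k)%N *
       fine (nu n (En n `&` [set x | `|z + tau *: (\sum_k w k *: e k) - x| <= eps])).
  apply: (@measure_jumps_ge _ _ _ n (En n) e rho Lam (nu n) _ _ _ _ _ _ _
    (ball z r) _ [set x | `|z - x| < delta]) => //.
  - exact: (jump_finite model).
  - by move=> k x; apply: (jump_rho_ge0 model).
  - by move=> k x; apply: (jump_step model).
  - exact: ltW.
  - move=> x nx; rewrite /Lam; apply: le_trans (_ : \sum_k `|C| <= _).
      apply: ler_sum => k _; apply: le_trans (rho_le k x nx) _; exact: ler_norm.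
    by rewrite -[leLHS]add0r lerD//; apply: ler_sum => k _; rewrite lerDl.
  - exact: nu_inv.
  - by move=> k; exact: ltW.
  - move=> [k|] x jk nx Gx /=; last first.
      rewrite lerB//; apply: ler_sum => k _; by have [] := rho_in k x nx Gx.
    have [_ ->//] := rho_in k x nx Gx.
    rewrite lt_neqAle w0 andbT; apply: contraTneq jk => wk.
    by rewrite /j /= -wk mulr0 mulr0 truncn0.
  - move=> x i nx zx ij /=; rewrite sstep opprD addrA.
    apply: le_lt_trans (ler_normB _ _) _.
    have zr : `|z - x| < delta - tau * L.
      by apply: lt_le_trans (ballP _ zx) _; rewrite /r ge_min lexx orbT.
    rewrite -(subrK (tau * L) delta) ltr_leD//.
    apply: le_trans (ler_norm_sum _ _ _) _; rewrite /L mulr_sumr.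
    apply: ler_sum => k _; rewrite normrZ mulrA ler_wpM2r//.
    rewrite ger0_norm ?divr_ge0// ler_pdivrMr// mulrC.
    apply: le_trans (_ : (j (Some k))%:R <= _); first by rewrite ler_nat.
    by have /andP[] := jP (Some k).
  - move=> x nx zx /=; rewrite sstep.
    have -> : z + tau *: (\sum_k w k *: e k) -
        (x + \sum_k ((j (Some k))%:R / n%:R) *: e k) =
        (z - x) + \sum_k (tau * w k - (j (Some k))%:R / n%:R) *: e k.
      rewrite opprD addrACA; congr (_ + _); rewrite scaler_sumr -sumrB.
      by apply: eq_bigr => k _; rewrite scalerA scalerBl.
    apply: le_trans (ler_normD _ _) _; rewrite [leRHS]splitr lerD//.
      by apply/ltW; apply: lt_le_trans (ballP _ zx) _; rewrite /r ge_min lexx.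
    apply: le_trans (ler_norm_sum _ _ _) _; apply: le_trans nle; rewrite mulr_sumr.
    apply: ler_sum => k _; rewrite normrZ ler_wpM2r//.
    have := jP (Some k); rewrite /= -natr1 => /andP[j1 j2].
    have -> : tau * w k - (j (Some k))%:R / n%:R =
        n%:R^-1 * (n%:R * (tau * w k) - (j (Some k))%:R).
      by field; rewrite gt_eqF.
    rewrite normrM gtr0_norm ?invr_gt0// ler_piMr ?invr_ge0//.
    by rewrite ler_norml; apply/andP; split; lra.
set N := (\sum_k j k)%N in key; set P := \prod_k _ in key.
set a := fine _ in key *; set b := fine _ in key *.
have P0 : 0 <= P by apply: prodr_ge0 => k _; rewrite divr_ge0 ?exprn_ge0// ltW.
have a0 : 0 <= a by exact: fine_ge0.
have LamN : 0 < Lam ^+ N by rewrite exprn_gt0.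
rewrite -(ler_pM2l LamN); apply: le_trans key; rewrite mulrA ler_wpM2r//.
set X := n%:R * _.
(* Both sides are multiplied by (n tau) ^+ N. The powers of n tau Lam are then bounded by N! * expR
   (n tau Lam), [P] turns into a product of Poisson weights, and expR (n tau Lam) occurs in both
   estimates and cancels. *)
have ntau : 0 < (n%:R * tau) ^+ N by rewrite exprn_gt0// mulr_gt0.
have NF : (0 : R) < N`!%:R by rewrite ltr0n fact_gt0.
have h1 : (n%:R * tau * Lam) ^+ N <= N`!%:R * expR (n%:R * tau * Lam).
  rewrite -ler_pdivrMl// mulrC; apply: pow_div_fact_le_expR.
  by rewrite !mulr_ge0// ltW.
have h2 : expR (n%:R * tau * Lam - X) <= (n%:R * tau) ^+ N * P.
  have -> : (n%:R * tau) ^+ N * P = \prod_k ((n%:R * (tau * m' k)) ^+ j k / (j k)`!%:R).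
    rewrite /N -prodrXr /P -big_split/=; apply: eq_bigr => k _.
    by rewrite [n%:R * (tau * _)]mulrA [in RHS]exprMn mulrA.
  apply: le_trans (_ : \prod_k expR (n%:R * (tau * w' k *
      ln (tau * m' k / (tau * w' k)) + tau * w' k - eta')) <= _); last first.
    by apply: ler_prod => k _; rewrite expR_ge0 pow.
  rewrite -expR_sum ler_expR -mulr_sumr /X -mulrA -mulrBr ler_wpM2l//.
  rewrite sumrB big_const/= iter_addr addr0 -mulr_natr.
  rewrite sum_option /=.
  rewrite divff ?mulf_neq0 ?gt_eqF// ln1 mulr0 add0r.
  have -> : eta' * #|xpredT : pred (option K)|%:R = eta.
    by rewrite /eta' (_ : #|xpredT : pred (option K)| = #|{: option K}|) ?divfK ?gt_eqF.
  have -> : \sum_k (tau * w k * ln (tau * m k / (tau * w k)) + tau * w k) =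
      - (tau * \sum_k (w k * ln (w k / m k) - w k)).
    rewrite mulr_sumr -sumrN; apply: eq_bigr => k _.
    have [->|wk] := eqVneq (w k) 0; first by rewrite !(mulr0, mul0r) subr0 mulr0 oppr0 addr0.
    have wk0 : 0 < w k by rewrite lt_neqAle eq_sym wk w0.
    rewrite -mulf_div divff ?gt_eqF// mul1r !ln_div ?posrE//; ring.
  by rewrite big_split/=; lra.
rewrite -(ler_pM2l ntau).
have -> : (n%:R * tau) ^+ N * (Lam ^+ N * expR (- X)) = (n%:R * tau * Lam) ^+ N * expR (- X).
  by rewrite [in RHS]exprMn mulrA.
apply: le_trans (_ : N`!%:R * expR (n%:R * tau * Lam) * expR (- X) <= _).
  by rewrite ler_wpM2r ?expR_ge0.
rewrite -mulrA -expRD mulrCA ler_wpM2l//.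
Unshelve. all: by end_near.
Qed.
End StraightLine.

(** * Passage from probabilities to the rate function *)

Lemma near_le_limn_esup {R : realType} (u u' : (\bar R)^nat) (K a b : R) :
  (\forall n \near \oo, (u' n <= u n + K%:E)%E) ->
  (limn_esup u <= a%:E)%E -> (b%:E <= limn_einf u')%E -> b <= a + K.
Proof.
move=> uu' ua bu'; apply/ler_addgt0Pr => h h0.
have : (limn_esup u < (a + h)%:E)%E by apply: le_lt_trans ua _; rewrite lte_fin ltrDl.
move=> /ereal_inf_lt[_ [V Voo <-] Vh].
have u'h : \forall n \near \oo, (u' n <= (a + K + h)%:E)%E.
  near=> n; apply: (@le_trans _ _ (u n + K%:E)%E); first by near: n.
  rewrite addrAC EFinD leeD2r//; apply: le_trans (ltW Vh).
  by apply: ereal_sup_ubound; exists n => //; near: n; exact: Voo.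
rewrite -lee_fin; apply: le_trans bu' _; apply: le_trans (limn_einf_sup _) _.
apply: ge_ereal_inf; eexists; first by exists (fun n => (u' n <= (a + K + h)%:E)%E).
by apply: ge_ereal_sup => _ [n hn <-].
Unshelve. all: by end_near.
Qed.

Lemma probability_support {R : realType} d (T : measurableType d) (nu : probability T R)
    (S B : set T) :
  measurable S -> measurable B -> nu S = 1%E -> nu B = nu (B `&` S).
Proof.
move=> mS mB nuS.
transitivity (nu (B `\` S) + nu (B `&` S))%E; first exact: measureDI.
suff -> : nu (B `\` S) = 0%E by rewrite add0e.
apply/eqP; rewrite eq_le measure_ge0 andbT.
have <- : nu (~` S) = 0%E by rewrite probability_setC// nuS subee.
by apply: le_measure; rewrite ?inE; [exact: measurableD|exact: measurableC|move=> x []].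
Qed.

Section RateAlongLine.
Context {R : realType} {d : nat} {K : finType}.
Variables (E : set 'rV[R]_d) (En : nat -> set 'rV[R]_d) (e : K -> 'rV[R]_d).
Variables (rho : nat -> K -> 'rV[R]_d -> R) (v : K -> 'rV[R]_d -> R).
Hypothesis model : jump_model E En e rho v.
Variable nu : nat -> probability (borel 'rV[R]_d) R.
Hypothesis nu_inv : forall n, (0 < n)%N ->
  invariant_measure (En n) (jump_generator e rho n) (nu n).
Variable I0 : 'rV[R]_d -> \bar R.
Hypothesis I0_LDP : LDP E nu I0.

Lemma rate_ge0 x : E x -> (0 <= I0 x)%E.
Proof. by case: I0_LDP => + _ _ _; apply. Qed.

Lemma rate_lsc x a : E x -> (a%:E < I0 x)%E ->
  exists2 r : R, 0 < r & forall y, E y -> `|x - y| < r -> (a%:E < I0 y)%E.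
Proof.
case: I0_LDP => _ lsc _ _ Ex /(lsc x)[V].
have -> : nbhs (x : subspace E) = within E (nbhs x) by rewrite (nbhs_subspace_in Ex).
move=> /nbhs_ballP[r /= r0 rV] aV; exists r => // y Ey xy; apply: aV.
by apply: rV; rewrite //-ball_normE.
Qed.

(** The large deviation lower bound is applied on an open ball around z and the upper bound on a
    closed ball around the end point; lower semi-continuity keeps the infimum over the closed ball
    above any bound that holds strictly at its centre. *)
Lemma rate_line_le (z : 'rV[R]_d) (w m M : K -> R) (delta tau kappa : R) :
  E z -> E (z + tau *: \sum_k w k *: e k) ->
  (forall k, 0 <= w k) -> (forall k, 0 < m k) -> 0 < tau -> 0 < kappa ->
  tau * (\sum_k w k * `|e k|) < delta ->
  (forall k x, E x -> `|z - x| < delta ->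
     v k x + kappa <= M k /\ (0 < w k -> m k + kappa <= v k x)) ->
  (I0 (z + tau *: \sum_k w k *: e k)%R <=
   I0 z + (tau * (\sum_k (w k * ln (w k / m k) - w k + M k)))%:E)%E.
Proof.
set y := z + _; set c := tau * \sum_k (_ - _ + _) => Ez Ey w0 m0 tau0 kappa0 wd vmM.
have := rate_ge0 Ez; case Iz : (I0 z) => [a| |]// a0; last by rewrite addye// leey.
rewrite -EFinD leNgt; apply/negP => acI.
(* Of the gap 2 eta, one eta is spent in [measure_line_ge] and the other leaves a strict
   contradiction. *)
have [eta eta0 acetaI] : exists2 eta : R, 0 < eta & ((a + c + 2 * eta)%:E < I0 y)%E.
  case Iy : (I0 y) => [b| |]; rewrite Iy in acI => //; last first.
    by exists 1 => //; rewrite ltry.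
  rewrite lte_fin in acI; exists ((b - (a + c)) / 4); first by lra.
  by rewrite lte_fin; lra.
have [r r0 rI] := rate_lsc Ey acetaI.
pose eps := r / 2.
have eps0 : 0 < eps by rewrite divr_gt0.
have [s s0 hs] := measure_line_ge model nu_inv w0 m0 tau0 kappa0 wd vmM eps0 eta0.
have mE : measurable (E : set (borel 'rV[R]_d)).
  rewrite -[E]setCK; apply: measurableC; apply: sub_sigma_algebra.
  apply: closed_openC; apply: compact_closed (jump_compact model).
  exact: norm_hausdorff.
pose A := ball z s; pose B := [set x | `|y - x| <= eps].
have oA : open A by exact: ball_open.
have cB : closed B by exact: closed_closed_ball_.
have mA : measurable (A : set (borel 'rV[R]_d)) by exact: sub_sigma_algebra.
have mB : measurable (B : set (borel 'rV[R]_d)).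
  rewrite -[B]setCK; apply: measurableC; apply: sub_sigma_algebra.
  exact: closed_openC.
have nuE n C : (0 < n)%N -> measurable (C : set (borel 'rV[R]_d)) ->
    nu n (E `&` C) = nu n (En n `&` C).
  move=> n0 mC; have finn := jump_finite model n0.
  have mEn : measurable (En n : set (borel 'rV[R]_d)).
    by apply: finite_borel_measurable => //; exact: norm_hausdorff.
  rewrite (@probability_support _ _ _ (nu n) (En n))//; last 2 first.
  - exact: measurableI.
  - by have [] := nu_inv n0.
  congr (nu n _); apply/seteqP; split=> x; first by move=> [[]].
  by move=> [nx Cx]; split=> //; split=> //; exact: (jump_sub model n0).
have [_ _ /(_ B cB) hB /(_ A oA) hA] := I0_LDP.
have infB : ((a + c + 2 * eta)%:E <= ereal_inf [set I0 x | x in E `&` B])%E.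
  apply: le_ereal_inf_tmp => _ [x [Ex Bx] <-]; apply/ltW/rI => //.
  by apply: le_lt_trans Bx _; rewrite /eps ltr_pdivrMr//; lra.
have infA : (ereal_inf [set I0 x | x in E `&` A] <= a%:E)%E.
  rewrite -Iz; apply: ereal_inf_lbound; exists z => //; split=> //.
  exact: ballxx.
suff : - a <= - (a + c + 2 * eta) + (c + eta) by lra.
apply: (near_le_limn_esup _ (le_trans hB _) (le_trans _ hA)); last 2 first.
- by rewrite EFinN leeN2.
- by rewrite EFinN leeN2.
near=> n.
have n0 : (0 < n)%N by near: n; exact: nbhs_infty_gt.
have nR0 : (0 : R) < n%:R by rewrite ltr0n.
rewrite !nuE//.
have : expR (- (n%:R * (c + eta))) * fine (nu n (En n `&` A)) <=
    fine (nu n (En n `&` B)) by near: n.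
have fin C : measurable (C : set (borel 'rV[R]_d)) ->
    exists2 q, 0 <= q & nu n (En n `&` C) = q%:E.
  move=> mC; exists (fine (nu n (En n `&` C))); first exact: fine_ge0.
  rewrite fineK// fin_num_measure//; apply: measurableI => //.
  apply: finite_borel_measurable; first exact: norm_hausdorff.
  exact: (jump_finite model).
have [p p0 ->] := fin _ mA; have [q q0 ->] := fin _ mB.
move=> h; have {h} pq : expR (- (n%:R * (c + eta))) * p <= q := h.
(* If the ball around z has mass 0, the logarithm is -oo and the inequality is trivial. *)
move: p0; rewrite le_eqVlt => /predU1P[<-|p0].
  by rewrite le0_lneNy// gt0_muleNy ?lte_fin ?invr_gt0// leNye.
have q_gt0 : 0 < q by apply: lt_le_trans pq; rewrite mulr_gt0// expR_gt0.
rewrite !lne_EFin// -!EFinM -EFinD lee_fin.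
have : ln (expR (- (n%:R * (c + eta))) * p) <= ln q.
  by rewrite ler_ln// posrE mulr_gt0// expR_gt0.
rewrite lnM ?posrE ?expR_gt0// expRK => lnpq.
have := ler_wpM2l (ltW (_ : 0 < n%:R^-1)) lnpq.
rewrite invr_gt0 => /(_ nR0); rewrite mulrDr mulrN mulKf ?gt_eqF//; lra.
Unshelve. all: by end_near.
Qed.
End RateAlongLine.

(** Relative entropy, per unit of time, of a Poisson process of intensity w with respect to one of
    intensity v. At v = 0 < w its value is - w instead of the expected +oo, so it is only used where
    0 < w implies 0 < v. *)
Definition entropy_cost {R : realType} (w v : R) : R := w * ln (w / v) - w + v.

(** The strict inequalities leave room for a rate close to v to remain bracketed by [m] and [M], at
    the price of eta in the cost. *)
Lemma entropy_cost_near {R : realType} (w v eta : R) :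
  0 <= w -> 0 <= v -> (0 < w -> 0 < v) -> 0 < eta ->
  exists m M, [/\ 0 < m, v < M, 0 < v -> m < v &
    \forall c \near 0^'+, forall w', 0 <= w' -> `|w' - w| < c -> (0 < w' -> 0 < v) ->
      w' * ln (w' / m) - w' + M <= entropy_cost w v + eta].
Proof.
rewrite /entropy_cost => w0 v0 wv eta0.
have [vE|vn] := eqVneq v 0.
  (* Here v = 0 forces every admissible w' to be 0, so any positive [m] will do. *)
  exists 1, (v + eta); split=> //; first by rewrite ltrDl.
    by rewrite vE ltxx.
  near=> c => w' w'0 _ w'v; have -> : w' = 0.
    by apply/eqP; apply: contraPT w'v => w'n; rewrite lt_neqAle eq_sym w'n w'0 vE ltxx => /(_ isT).
  have -> : w = 0.
    by apply/eqP; apply: contraPT wv => wn; rewrite lt_neqAle eq_sym wn w0 vE ltxx => /(_ isT).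
  by rewrite !mul0r; lra.
have vp : 0 < v by rewrite lt_neqAle eq_sym vn.
(* The slack [io] is paid once through [M] and at most w + 1 times through [m], in total eta / 2;
   the other half of eta pays for the deviation of w' from w, through the constant [D] below. *)
pose io := eta / (2 * (w + 2)).
have io0 : 0 < io by rewrite divr_gt0// mulr_gt0//; lra.
have m0 : 0 < v / (1 + io) by rewrite divr_gt0//; lra.
exists (v / (1 + io)), (v + io); split=> //.
- by rewrite ltrDl.
- by rewrite ltr_pdivrMr ?ltr_pMr; lra.
have ioE : io * (w + 2) = eta / 2 by rewrite /io; field; rewrite gt_eqF//; lra.
have iow : io * w >= 0 by rewrite mulr_ge0// ltW.
have [wE|wn] := eqVneq w 0.
  near=> c => w' w'0; rewrite wE subr0 ger0_norm// => w'c _.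
  have w'm : w' <= v / (1 + io).
    by apply/ltW/(lt_trans w'c); near: c; exact: nbhs_right_lt.
  rewrite mul0r; have : w' * ln (w' / (v / (1 + io))) <= 0.
    rewrite mulr_ge0_le0// ln_le0// ler_pdivrMr ?mul1r//.
  rewrite wE in ioE; lra.
have wp : 0 < w by rewrite lt_neqAle eq_sym wn.
pose D := `|ln (w / v)| + (w + 1) / w + 1.
have D0 : 0 < D by rewrite ltr_pwDr// addr_ge0// divr_ge0//; lra.
near=> c => w' w'0 w'c _.
have c1 : c < 1 by near: c; exact: nbhs_right_lt.
have cD : c * D <= eta / 2.
  rewrite -ler_pdivlMr//; near: c; apply: nbhs_right_le; by rewrite !divr_gt0.
have c0 : 0 < c by [].
have h1 : w' * ln (w' / (v / (1 + io))) <=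
    w' * ln (w / v) + w' * io + w' * (w' / w - 1).
  have [->|w'n] := eqVneq w' 0; first by rewrite !mul0r; lra.
  have w'p : 0 < w' by rewrite lt_neqAle eq_sym w'n.
  rewrite -!mulrDr ler_pM2l//.
  have -> : w' / (v / (1 + io)) = (w / v) * (1 + io) * (w' / w).
    by field; rewrite !gt_eqF//; lra.
  have io1 : 0 < 1 + io by rewrite addr_gt0.
  rewrite lnM ?posrE ?mulr_gt0 ?divr_gt0 ?invr_gt0//.
  rewrite lnM ?posrE ?divr_gt0//.
  rewrite lerD// ?ln_le_subr1 ?divr_gt0// lerD2l.
  by apply: le_trans (ln_le_subr1 _) _; rewrite ?io1// addrAC subrr add0r.
move: (w'c); rewrite ltr_norml => /andP[wl wr].
have h2 : (w' - w) * ln (w / v) <= c * `|ln (w / v)|.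
  apply: le_trans (ler_norm _) _; rewrite normrM ler_wpM2r//; exact: ltW.
have w'1 : w' <= w + 1 by rewrite -lerBlDl; exact: ltW (lt_trans wr c1).
have h3 : w' * (w' / w - 1) <= c * ((w + 1) / w).
  have -> : w' * (w' / w - 1) = (w' - w) * (w' / w) by field.
  apply: le_trans (_ : c * (w' / w) <= _).
    by rewrite ler_wpM2r ?divr_ge0// ltW.
  by rewrite ler_wpM2l ?ler_wpM2r ?invr_ge0// ltW.
have h4 : w' * io <= (w + 1) * io by rewrite ler_wpM2r// ltW.
rewrite /D !mulrDr mulr1 in cD.
lra.
Unshelve. all: by end_near.
Qed.

Lemma within_continuous_norm {R : realType} {V : normedModType R} (E : set V)
    (f : V -> R) z eps : {within E, continuous f} -> E z -> 0 < eps ->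
  exists2 r : R, 0 < r & forall x, E x -> `|z - x| < r -> `|f z - f x| < eps.
Proof.
move=> cf Ez eps0; have := cf z.
rewrite /continuous_at /=.
have -> : nbhs (z : subspace E) = within E (nbhs z) by rewrite (nbhs_subspace_in Ez).
move=> /cvgrPdist_lt/(_ _ eps0)/nbhs_ballP[r /= r0 h]; exists r => // x Ex zx.
by apply: h => //; rewrite -ball_normE.
Qed.

Section LocalRate.
Context {R : realType} {d : nat} {K : finType}.
Variables (E : set 'rV[R]_d) (En : nat -> set 'rV[R]_d) (e : K -> 'rV[R]_d).
Variables (rho : nat -> K -> 'rV[R]_d -> R) (v : K -> 'rV[R]_d -> R).
Hypothesis model : jump_model E En e rho v.
Variable nu : nat -> probability (borel 'rV[R]_d) R.
Hypothesis nu_inv : forall n, (0 < n)%N ->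
  invariant_measure (En n) (jump_generator e rho n) (nu n).
Variable I0 : 'rV[R]_d -> \bar R.
Hypothesis I0_LDP : LDP E nu I0.

(** [w] is kept distinct from the rates at z because in the Glauber model a shifted path moves with
    the intensities of the original one. Uniformity in [w'] is needed since the mean intensities
    over a time step differ from those at its start. *)
Lemma rate_local_le (z : 'rV[R]_d) (w : K -> R) (eta : R) :
  E z -> (forall k, 0 <= w k) -> (forall k, 0 < w k -> 0 < v k z) -> 0 < eta ->
  exists2 c : R, 0 < c & forall (tau : R) (w' : K -> R), 0 < tau -> tau < c ->
    (forall k, 0 <= w' k) -> (forall k, `|w' k - w k| < c) ->
    (forall k, 0 < w' k -> 0 < v k z) ->
    E (z + tau *: \sum_k w' k *: e k) ->
    (I0 (z + tau *: \sum_k w' k *: e k)%R <=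
     I0 z + (tau * (\sum_k entropy_cost (w k) (v k z) + eta))%:E)%E.
Proof.
move=> Ez w0 wv eta0.
pose eta' := eta / (#|K|.+1)%:R.
have eta'0 : 0 < eta' by rewrite divr_gt0.
have vz0 k : 0 <= v k z by exact: (jump_v_ge0 model).
have /choice[m] k := entropy_cost_near (w0 k) (vz0 k) (wv k) eta'0.
move=> /choice[M] mM.
have near1 k : \forall c \near 0^'+, forall w', 0 <= w' -> `|w' - w k| < c ->
    (0 < w' -> 0 < v k z) ->
    w' * ln (w' / m k) - w' + M k <= entropy_cost (w k) (v k z) + eta'.
  by have [] := mM k.
have near2 k : \forall c \near 0^'+, forall x, E x -> `|z - x| < c ->
    v k x + c <= M k /\ (0 < v k z -> m k + c <= v k x).
  have [_ vM mv _] := mM k.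
  (* The value 1 stands for no constraint: at v k z = 0 no lower bound on the rate is claimed. *)
  pose g := Num.min (M k - v k z) (if 0 < v k z then v k z - m k else 1).
  have g0 : 0 < g.
    rewrite lt_min subr_gt0 vM/=; case: ifPn => // h; by rewrite subr_gt0 mv.
  have g2 : 0 < g / 2 by rewrite divr_gt0.
  have cv : {within E, continuous (v k)} by exact: (jump_v_continuous model).
  have [r r0 hr] := within_continuous_norm cv Ez g2.
  near=> c => x Ex zx.
  have cg : c <= g / 2 by near: c; apply: nbhs_right_le.
  have : `|v k z - v k x| < g / 2.
    apply: hr => //; apply: lt_le_trans zx _.
    by near: c; exact: nbhs_right_le.
  rewrite ltr_norml => /andP[h1 h2].
  have gM : g <= M k - v k z by rewrite /g ge_min lexx.
  split; first lra.
  move=> vk; have : g <= v k z - m k by rewrite /g vk ge_min lexx orbT.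
  lra.
have : \forall c \near 0^'+, 0 < c /\
  (forall k, (forall w', 0 <= w' -> `|w' - w k| < c ->
    (0 < w' -> 0 < v k z) ->
    w' * ln (w' / m k) - w' + M k <= entropy_cost (w k) (v k z) + eta')) /\
  (forall k, forall x, E x -> `|z - x| < c ->
    v k x + c <= M k /\ (0 < v k z -> m k + c <= v k x)).
  near=> c; split=> //; split; near: c; exact: filter_forall.
move=> /filter_ex[c [c0 [hw hv]]].
pose W := \sum_k (w k + c) * `|e k| + 1.
have W0 : 0 < W.
  by rewrite ltr_pwDr// sumr_ge0// => k _; rewrite mulr_ge0// addr_ge0// ltW.
exists (Num.min c (c / W)); first by rewrite lt_min c0 divr_gt0.
move=> tau w'; rewrite !lt_min => tau0 /andP[tauc tauW] w'0 w'w w'v Ey.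
have w'wc k : `|w' k - w k| < c.
  by have := w'w k; rewrite lt_min => /andP[].
have m0 k : 0 < m k by have [] := mM k.
apply: le_trans (rate_line_le model nu_inv I0_LDP (m := m) (M := M) (delta := c)
  (kappa := c) Ez Ey w'0 m0 tau0 c0 _ _) _.
- apply: (@lt_trans _ _ (tau * W)); last by rewrite -ltr_pdivlMr.
  rewrite ltr_pM2l// /W ltr_pwDr//; apply: ler_sum => k _; rewrite ler_wpM2r//.
  by have := w'wc k; rewrite ltr_norml => /andP[]; lra.
- move=> k x Ex zx; have [h1 h2] := hv k x Ex zx; split=> // wk.
  exact/h2/w'v.
rewrite leeD2l// lee_fin ler_pM2l//.
apply: le_trans (_ : \sum_k (entropy_cost (w k) (v k z) + eta') <= _).
  by apply: ler_sum => k _; apply: hw => //; exact: w'v.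
rewrite big_split/= lerD2l sumr_const -mulr_natr /eta' -mulrA ler_piMr ?(ltW eta0)//.
by rewrite mulrC ler_pdivrMr// mul1r ler_nat.
Unshelve. all: by end_near.
Qed.
End LocalRate.

(** * Decay along curves *)

(** The set of times at which the bound holds contains its supremum, by lower semi-continuity from
    the left, and one more step would exceed a supremum below T. No uniformity in t of the step
    length [c] is involved. *)
Lemma rate_decay_le {R : realType} (g : R -> \bar R) (T eta : R) :
  0 <= T -> 0 <= eta ->
  (forall t a, 0 < t -> t <= T -> (a%:E < g t)%E ->
     exists2 r : R, 0 < r & forall u, 0 <= u -> u <= t -> t - u < r -> (a%:E < g u)%E) ->
  (forall t, 0 <= t -> t < T ->
     exists2 c : R, 0 < c & forall h, 0 < h -> h < c -> t + h <= T ->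
       (g (t + h)%R <= g t + (eta * h)%:E)%E) ->
  g 0 != -oo%E -> (g T <= g 0%R + (eta * T)%:E)%E.
Proof.
move=> T0 eta0 lsc step; case g0 : (g 0) => [a| |]// _; last by rewrite addye// leey.
pose S := [set t | 0 <= t <= T /\ (g t <= (a + eta * t)%:E)%E].
have S0 : S 0 by split; rewrite ?lexx// mulr0 addr0 g0.
have hS : has_sup S.
  by split; [exists 0|exists T => t [/andP[]]].
pose t := sup S.
have t0 : 0 <= t by apply: ub_le_sup => //; exact: hS.2.
have tT : t <= T by apply: ge_sup => //; [exists 0|move=> u [/andP[]]].
have St : S t.
  have [tz|tn] := eqVneq t 0; first by rewrite tz.
  have tp : 0 < t by rewrite lt_neqAle eq_sym tn.
  split; first by rewrite t0.
  rewrite leNgt; apply/negP => /(lsc _ _ tp tT)[r r0 hr].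
  have [u [/andP[u0 uT] gu] ur] := sup_adherent r0 hS.
  have ut : u <= t by apply: ub_le_sup; [exact: hS.2|split; rewrite ?u0].
  have := hr u u0 ut; rewrite -/t in ur => /(_ ltac:(lra)).
  apply/negP; rewrite -leNgt; apply: le_trans gu _.
  by rewrite lee_fin lerD2l ler_wpM2l.
have [tE|tn] := eqVneq t T; first by rewrite -EFinD -tE; case: St.
have tlt : t < T by rewrite lt_neqAle tn.
have [c c0 hc] := step t t0 tlt.
pose h := Num.min (c / 2) (T - t).
have h0 : 0 < h by rewrite lt_min divr_gt0// subr_gt0.
have hcc : h < c by rewrite gt_min; apply/orP; left; rewrite ltr_pdivrMr//; lra.
have hT : t + h <= T by rewrite -lerBrDl ge_min lexx orbT.
suff : S (t + h).
  by move=> /(ub_le_sup hS.2); rewrite -/t gerDl leNgt h0.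
split; first by rewrite hT andbT addr_ge0// ltW.
apply: le_trans (hc h h0 hcc hT) _.
have [_ gt] := St; apply: le_trans (leeD2r _ gt) _.
by rewrite -EFinD lee_fin mulrDr addrA.
Qed.

(** A monotonicity criterion through right derivatives, the only ones that a solution has at time
    0. *)
Lemma real_decay_le {R : realType} (f : R -> R) (T : R) :
  0 <= T ->
  (forall t eps, 0 < t -> t <= T -> 0 < eps ->
     exists2 r : R, 0 < r & forall u, 0 <= u -> u <= t -> t - u < r -> `|f t - f u| < eps) ->
  (forall t eps, 0 <= t -> t < T -> 0 < eps ->
     exists2 c : R, 0 < c & forall h, 0 < h -> h < c -> f (t + h) <= f t + eps * h) ->
  f T <= f 0.
Proof.
move=> T0 cf step; apply/ler_addgt0Pr => eps eps0.
pose eta := eps / (T + 1).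
have eta0 : 0 < eta by rewrite divr_gt0//; lra.
have := @rate_decay_le R (EFin \o f) T eta T0 (ltW eta0); rewrite /= -EFinD lee_fin.
move=> /(_ _ _ isT) h; apply: le_trans (h _ _) _.
- move=> t a t0 tT; rewrite lte_fin => aft.
  have [r r0 hr] := cf t (f t - a) t0 tT (ltac:(by rewrite subr_gt0)).
  exists r => // u u0 ut /(hr u u0 ut); rewrite lte_fin ltr_norml => /andP[_]; lra.
- move=> t t0 tT; have [c c0 hc] := step t eta t0 tT eta0; exists c => // k k0 kc _.
  by rewrite -EFinD lee_fin; exact: hc.
- by rewrite lerD2l /eta mulrAC ler_pdivrMr ?ler_wpM2l//; [exact: ltW|lra|lra].
Qed.

Lemma antiderivative_exists {R : realType} (f : R -> R) : continuous f ->
  exists G : R -> R, forall t : R, 0 <= t -> is_derive t 1 G (f t).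
Proof.
(* The base point -1 makes every t >= 0 an interior point, so that the derivative at 0 is
   two-sided. *)
move=> cf; exists (fun y => (\int[lebesgue_measure]_(t in `[(-1)%R, y]) f t)%R) => t t0.
have [] := @continuous_FTC1_closed R f (-1) t (t + 1) _ _ _ (cf t).
- by rewrite ltrDl.
- apply: continuous_compact_integrable; first exact: segment_compact.
  exact: continuous_subspaceT.
- by rewrite (lt_le_trans _ t0).
move=> dF FE; apply: (DeriveDef dF).
exact: (etrans (esym (derive1E _ _)) FE).
Qed.

(** * Regularity of solutions and calculus with right derivatives *)

Section Solutions.
Context {R : realType} {d : nat}.
Variables (E : set 'rV[R]_d) (F : 'rV[R]_d -> 'rV[R]_d) (x : R -> 'rV[R]_d).
Hypothesis x_sol : solution E F x.

Lemma solution_in t : 0 <= t -> E (x t).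
Proof. by case: x_sol => + _ _; apply. Qed.

Lemma solution_right_derive t eps : 0 <= t -> 0 < eps ->
  exists2 c : R, 0 < c & forall h, 0 < h -> h < c ->
    `|h^-1 *: (x (t + h) - x t) - F (x t)| < eps.
Proof.
case: x_sol => _ dx dx0; rewrite le_eqVlt => /predU1P[<-|t0] eps0.
  move/cvgrPdist_lt : dx0 => /(_ _ eps0) [c /= c0 hc]; exists c => // h h0 hc'.
  rewrite add0r distrC; apply: hc => //=.
  by rewrite /ball/= sub0r normrN gtr0_norm.
have [+ dE] := dx t t0.
rewrite /derivable => /cvg_ex[l hl]; have lE : l = F (x t).
  by rewrite -dE /derive; apply/esym/cvg_lim.
move: hl; rewrite lE => /cvgrPdist_lt/(_ _ eps0)[c /= c0 hc].
exists c => // h h0 hc'; rewrite distrC.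
have := hc h; rewrite /ball/= sub0r normrN gtr0_norm// => /(_ hc' (lt0r_neq0 h0)).
by rewrite [h%:A]mulr1 [h + t]addrC. 
Qed.

Lemma solution_continuous t eps : 0 <= t -> 0 < eps ->
  exists2 c : R, 0 < c & forall u, 0 <= u -> `|t - u| < c -> `|x t - x u| < eps.
Proof.
case: x_sol => _ dx dx0; rewrite le_eqVlt => /predU1P[<-|t0] eps0.
  (* At time 0 continuity has to come from the one-sided derivative: difference quotients are
     eventually below |F (x 0)| + 1. *)
  have [c c0 hc] := solution_right_derive (lexx 0) ltr01.
  exists (Num.min c (eps / (`|F (x 0)| + 1))).
    by rewrite lt_min c0 divr_gt0// ltr_pwDr.
  move=> u; rewrite le_eqVlt => /predU1P[<- _|u0]; first by rewrite [x 0 - _]subrr normr0.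
  rewrite sub0r normrN gtr0_norm// lt_min => /andP[uc ueps].
  have := hc u u0 uc; rewrite add0r => hu.
  have : `|u^-1 *: (x u - x 0)| < `|F (x 0)| + 1.
    rewrite -[u^-1 *: _](subrK (F (x 0))) addrC.
    by apply: le_lt_trans (ler_normD _ _) _; rewrite ltrD2l.
  rewrite normrZ gtr0_norm ?invr_gt0// ltr_pdivrMl// distrC => /lt_trans; apply.
  by rewrite -ltr_pdivlMr// ltr_pwDr.
have [/derivable1_diffP/differentiable_continuous + _] := dx t t0.
move=> /cvgrPdist_lt/(_ _ eps0)/nbhs_ballP[c /= c0 hc]; exists c => // u u0 tu.
by apply: hc; rewrite -ball_normE.
Qed.
End Solutions.

(* Only right derivatives are required, so that time 0 is not special. *)
Definition right_primitive {R : realType} (f g : R -> R) : Prop :=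
  forall t eps : R, 0 <= t -> 0 < eps ->
    (exists2 c : R, 0 < c & forall u : R, 0 <= u -> `|t - u| < c -> `|f t - f u| < eps) /\
    (exists2 c : R, 0 < c & forall h : R, 0 < h -> h < c ->
       `|h^-1 * (f (t + h) - f t) - g t| < eps).

Section RightPrimitive.
Context {R : realType}.
Implicit Types f g : R -> R.

Lemma right_primitive_derive f g :
  (forall t : R, 0 <= t -> is_derive t 1 f (g t)) -> right_primitive f g.
Proof.
move=> df t eps t0 eps0; have dft := df t t0; split.
  have [/derivable1_diffP/differentiable_continuous + _] := dft.
  move=> /cvgrPdist_lt/(_ _ eps0)/nbhs_ballP[c /= c0 hc]; exists c => // u u0 tu.
  by apply: hc; rewrite -ball_normE.
have [+ dE] := dft.
rewrite /derivable => /cvg_ex[l hl]; have lE : l = g t.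
  by rewrite -dE /derive; apply/esym/cvg_lim.
move: hl; rewrite lE => /cvgrPdist_lt/(_ _ eps0)[c /= c0 hc].
exists c => // h h0 hc'; rewrite distrC.
have := hc h; rewrite /ball/= sub0r normrN gtr0_norm// => /(_ hc' (lt0r_neq0 h0)).
by rewrite [h%:A]mulr1 [h + t]addrC.
Qed.

Lemma right_primitive_eq f f' g g' : right_primitive f g ->
  (forall t, f t = f' t) -> (forall t, 0 <= t -> g t = g' t) -> right_primitive f' g'.
Proof.
move=> fg /funext <- gg' t eps t0 eps0.
by have [h1 [c c0 hc]] := fg t eps t0 eps0; split=> //; exists c => //; rewrite -gg'.
Qed.

Lemma right_primitive0 : right_primitive (fun=> 0) (fun=> 0 : R).
Proof.
by move=> t eps t0 eps0; split; exists 1 => // u _ _; rewrite !subrr ?mulr0 ?subrr normr0.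
Qed.

Lemma right_primitive_lin a f f' g g' :
  right_primitive f g -> right_primitive f' g' ->
  right_primitive (fun t => a * f t + f' t) (fun t => a * g t + g' t).
Proof.
move=> fg fg' t eps t0 eps0.
pose e1 := eps / (2 * (`|a| + 1)).
have a1 : 0 < `|a| + 1 by rewrite ltr_pwDr.
have e10 : 0 < e1 by rewrite divr_gt0// mulr_gt0.
have e20 : 0 < eps / 2 by rewrite divr_gt0.
have ae1 y : `|y| < e1 -> `|a * y| <= eps / 2.
  move=> ye; rewrite normrM; apply: le_trans (_ : (`|a| + 1) * e1 <= _).
    by rewrite ler_pM ?lerDl// ltW.
  by rewrite /e1 le_eqVlt; apply/orP; left; apply/eqP; field; rewrite gt_eqF.
have [[c c0 hc] [h h0 hh]] := fg t e1 t0 e10.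
have [[c' c'0 hc'] [h' h'0 hh']] := fg' t (eps / 2) t0 e20.
split.
  exists (Num.min c c'); first by rewrite lt_min c0.
  move=> u u0; rewrite lt_min => /andP[uc uc'].
  rewrite opprD addrACA -mulrBr [ltRHS]splitr; apply: le_lt_trans (ler_normD _ _) _.
  by rewrite ler_ltD ?ae1 ?hc ?hc'.
exists (Num.min h h'); first by rewrite lt_min h0.
move=> u u0; rewrite lt_min => /andP[uc uc'].
have -> : u^-1 * (a * f (t + u) + f' (t + u) - (a * f t + f' t)) - (a * g t + g' t) =
  a * (u^-1 * (f (t + u) - f t) - g t) + (u^-1 * (f' (t + u) - f' t) - g' t) by ring.
rewrite [ltRHS]splitr; apply: le_lt_trans (ler_normD _ _) _.
by rewrite ler_ltD ?ae1 ?hh ?hh'.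
Qed.

Lemma right_primitive_sum (K : Type) (r : seq K) (a : K -> R) (f g : K -> R -> R) :
  (forall k, right_primitive (f k) (g k)) ->
  right_primitive (fun t => \sum_(k <- r) a k * f k t) (fun t => \sum_(k <- r) a k * g k t).
Proof.
move=> fg; elim: r => [|k r IH].
  by apply: right_primitive_eq right_primitive0 _ _ => t; rewrite big_nil.
by apply: right_primitive_eq (right_primitive_lin (a k) (fg k) IH) _ _ => t;
  rewrite big_cons.
Qed.

Lemma right_primitive_le f g s t : right_primitive f g -> 0 <= s -> s <= t ->
  (forall u, s <= u -> u < t -> g u <= 0) -> f t <= f s.
Proof.
move=> fg s0 st g0; have := @real_decay_le R (fun u => f (s + u)) (t - s).
rewrite addr0 subrKC; apply; first by rewrite subr_ge0.
- move=> u eps u0 ut eps0; have [|[c c0 hc] _] := fg (s + u) eps _ eps0.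
    by rewrite addr_ge0// ltW.
  exists c => // r r0 ru ur; apply: hc; first by rewrite addr_ge0.
  by rewrite opprD addrACA subrr add0r ger0_norm ?subr_ge0.
- move=> u eps u0 ut eps0; have [|_ [c c0 hc]] := fg (s + u) eps _ eps0.
    by rewrite addr_ge0.
  exists c => // h h0 hhc; have := hc h h0 hhc; rewrite addrA ltr_norml => /andP[_].
  have gu : g (s + u) <= 0 by apply: g0; [rewrite lerDl|rewrite -ltrBrDl].
  move=> hh; have : h^-1 * (f (s + u + h) - f (s + u)) <= eps by lra.
  by rewrite ler_pdivrMl// mulrC; lra.
Qed.

Lemma right_primitive_ge f g s t :
  right_primitive f g -> 0 <= s -> s <= t ->
  (forall u, s <= u -> u < t -> 0 <= g u) -> f s <= f t.
Proof.
move=> fg s0 st g0.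
have := right_primitive_le (right_primitive_lin (-1) fg right_primitive0) s0 st.
rewrite !addr0 !mulN1r lerN2; apply => u su ut.
by rewrite addr0 mulN1r oppr_le0; exact: g0.
Qed.

Lemma right_primitive_cst f s t : right_primitive f (fun=> 0) -> 0 <= s -> s <= t ->
  f t = f s.
Proof.
move=> f0 s0 st; apply/eqP; rewrite eq_le (right_primitive_le f0)//=.
have := right_primitive_le (right_primitive_lin (-1) f0 right_primitive0) s0 st.
by rewrite mulr0 addr0 => /(_ (fun _ _ _ => lexx _)); lra.
Qed.
End RightPrimitive.

(** * Increments of solutions as sums of jumps *)

Section SolutionFlux.
Context {R : realType} {d : nat} {K : finType}.
Variables (E : set 'rV[R]_d) (F : 'rV[R]_d -> 'rV[R]_d) (x : R -> 'rV[R]_d).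
Hypothesis x_sol : solution E F x.

Lemma coord_le_norm (y : 'rV[R]_d) i : `|y ord0 i| <= `|y|.
Proof.
by rewrite /Num.norm/= mx_normE; apply: (@le_bigmax _ _ _ _ (fun ij => `|y ij.1 ij.2|%:nng) (ord0, i)).
Qed.

Lemma solution_coord i :
  right_primitive (fun t => x t ord0 i) (fun t => F (x t) ord0 i).
Proof.
move=> t eps t0 eps0; split.
  have [c c0 hc] := solution_continuous x_sol t0 eps0; exists c => // u u0 tu.
  have := coord_le_norm (x t - x u) i; rewrite !mxE => /le_lt_trans; apply.
  exact: hc.
have [c c0 hc] := solution_right_derive x_sol t0 eps0; exists c => // h h0 hhc.
have := coord_le_norm (h^-1 *: (x (t + h) - x t) - F (x t)) i.
rewrite !mxE => /le_lt_trans; apply; exact: hc.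
Qed.

Variables (e : K -> 'rV[R]_d) (v : K -> 'rV[R]_d -> R).
Hypothesis v_cont : forall k, {within E, continuous (v k)}.
Hypothesis FE : forall y, E y -> F y = \sum_k v k y *: e k.

(** The mean value theorem is applied to an antiderivative of each rate separately. The times [u k]
    therefore differ, but the identity is exact and each coefficient is a value of [v k] on the
    path, hence inherits its sign and vanishes where the rate does. *)
Lemma solution_flux s h : 0 <= s -> 0 < h -> exists u : K -> R,
  (forall k, s <= u k <= s + h) /\
  x (s + h) = x s + h *: \sum_k v k (x (u k)) *: e k.
Proof.
move=> s0 h0.
(* Values at negative times are arbitrary; freezing the path there makes the rates continuous on the
   whole line. *)
pose xx (t : R) := x (Num.max t 0).
have cx k : continuous (fun t => v k (xx t)).
  move=> t; apply/cvgrPdist_lt => eps eps0.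
  have m0 : 0 <= Num.max t 0 by rewrite le_max lexx orbT.
  have [r r0 hr] := within_continuous_norm (@v_cont k) (solution_in x_sol m0) eps0.
  have [c c0 hc] := solution_continuous x_sol m0 r0.
  exists c => //= u tu; apply: hr; first by apply: (solution_in x_sol); rewrite le_max lexx orbT.
  apply: hc; first by rewrite le_max lexx orbT.
  apply: le_lt_trans tu.
  have [t0|t0] := leP t 0; have [u0|u0] := leP u 0; rewrite ?subrr ?normr0//;
    rewrite ler_norml; have := ler_norm (t - u); have := ler_norm (u - t);
    rewrite distrC => h1 h2; apply/andP; split; lra.
have /choice[G dG] k := antiderivative_exists (cx k).
have rG k : right_primitive (G k) (fun t => v k (xx t)).
  by apply: right_primitive_derive => t t0; exact: dG.
have sumE (f : K -> 'rV[R]_d) i : (\sum_k f k) ord0 i = \sum_k f k ord0 i.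
  exact: summxE.
have xxE t : 0 <= t -> xx t = x t by move=> t0; rewrite /xx max_l.
have cst i : - x (s + h) ord0 i + \sum_k e k ord0 i * G k (s + h) =
             - x s ord0 i + \sum_k e k ord0 i * G k s.
  have := right_primitive_lin (-1) (solution_coord i)
    (right_primitive_sum (index_enum K) (fun k => e k ord0 i) rG).
  move=> h1; have h2 := @right_primitive_eq _ _ _ _ (fun=> 0) h1 (fun=> erefl).
  have := @right_primitive_cst _ _ s (s + h) (h2 _) s0.
  rewrite !mulN1r; apply; last by rewrite lerDl ltW.
  move=> t t0; rewrite FE; last exact: (solution_in x_sol).
  rewrite sumE mulN1r addrC -sumrB big1// => k _.
  by rewrite xxE// !mxE mulrC subrr.
have mvt k : exists u, s <= u <= s + h /\ G k (s + h) - G k s = h * v k (x u).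
  have [|||u] := @MVT R (G k) (fun t => v k (xx t)) s (s + h).
  - by rewrite ltrDl.
  - by move=> t; rewrite in_itv/= => /andP[st _]; apply: dG; rewrite (le_trans s0)// ltW.
  - apply: continuous_in_subspaceT => t; rewrite inE/= in_itv/= => /andP[st _].
    have [+ _] := dG k t (le_trans s0 st).
    by move/derivable1_diffP/differentiable_continuous.
  rewrite in_itv/= => /andP[su us] GE; exists u; split; first by rewrite !ltW.
  by rewrite GE xxE 1?mulrC ?(le_trans s0) ?ltW// [s + h]addrC addrK.
have /choice[u hu] := mvt.
exists u; split=> [k|]; first by have [] := hu k.
apply/rowP => i; rewrite !mxE sumE mulr_sumr.
have -> : \sum_k h * (v k (x (u k)) *: e k) ord0 i = \sum_k e k ord0 i * (G k (s + h) - G k s).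
  by apply: eq_bigr => k _; have [_ ->] := hu k; rewrite !mxE; ring.
under eq_bigr do rewrite mulrBr.
rewrite sumrB; have := cst i; lra.
Qed.
End SolutionFlux.

(** * The rate function along paths *)

Section RateAlongPaths.
Context {R : realType} {d : nat} {K : finType}.
Variables (E : set 'rV[R]_d) (En : nat -> set 'rV[R]_d) (e : K -> 'rV[R]_d).
Variables (rho : nat -> K -> 'rV[R]_d -> R) (v : K -> 'rV[R]_d -> R).
Hypothesis model : jump_model E En e rho v.
Variable nu : nat -> probability (borel 'rV[R]_d) R.
Hypothesis nu_inv : forall n, (0 < n)%N ->
  invariant_measure (En n) (jump_generator e rho n) (nu n).
Variable I0 : 'rV[R]_d -> \bar R.
Hypothesis I0_LDP : LDP E nu I0.

Lemma rate_path_le (phi : R -> 'rV[R]_d) (T eta : R) :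
  0 <= T -> 0 <= eta ->
  (forall t, 0 <= t -> t <= T -> E (phi t)) ->
  (forall t eps : R, 0 <= t -> 0 < eps -> exists2 c : R, 0 < c &
     forall u : R, 0 <= u -> `|t - u| < c -> `|phi t - phi u| < eps) ->
  (forall t : R, 0 <= t -> t < T -> exists2 c : R, 0 < c &
     forall h, 0 < h -> h < c -> t + h <= T ->
       (I0 (phi (t + h)%R) <= I0 (phi t) + (eta * h)%:E)%E) ->
  (I0 (phi T) <= I0 (phi 0%R) + (eta * T)%:E)%E.
Proof.
move=> T0 eta0 phiE cphi step; apply: (@rate_decay_le _ (I0 \o phi)) => //.
  move=> t a t0 tT aI; have Et : E (phi t) by apply: phiE => //; exact: ltW.
  have [r r0 hr] := rate_lsc I0_LDP Et aI.
  have [c c0 hc] := cphi t r (ltW t0) r0; exists c => // u u0 ut tu.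
  apply: hr; first by apply: phiE => //; exact: le_trans tT.
  by apply: hc => //; rewrite ger0_norm// subr_ge0.
have := rate_ge0 I0_LDP (phiE 0 (lexx _) T0); rewrite /=.
by case: (I0 _).
Qed.

Lemma rate_solution_le (F : 'rV[R]_d -> 'rV[R]_d) (x : R -> 'rV[R]_d) :
  solution E F x ->
  (forall s eta : R, 0 <= s -> 0 < eta -> exists2 c : R, 0 < c & forall h, 0 < h -> h < c ->
     (I0 (x (s + h)%R) <= I0 (x s) + (eta * h)%:E)%E) ->
  forall s t, 0 <= s -> s <= t -> (I0 (x t) <= I0 (x s))%E.
Proof.
move=> x_sol step s t s0 st; apply/lee_addgt0Pr => eps eps0.
have T0 : 0 <= t - s by rewrite subr_ge0.
pose eta := eps / (t - s + 1).
have eta0 : 0 < eta by rewrite divr_gt0// ltr_pwDr.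
have : (I0 (x (s + (t - s))%R) <= I0 (x (s + 0)%R) + (eta * (t - s))%:E)%E.
  apply: (@rate_path_le (fun u => x (s + u))) => //.
  - exact: ltW.
  - by move=> u u0 _; apply: (solution_in x_sol); rewrite addr_ge0.
  - move=> u c u0 c0; have [r r0 hr] := solution_continuous x_sol (addr_ge0 s0 u0) c0.
    exists r => // w w0 uw; apply: hr; first by rewrite addr_ge0.
    by rewrite opprD addrACA subrr add0r.
  - move=> u u0 _; have [c c0 hc] := step (s + u) eta (addr_ge0 s0 u0) eta0.
    by exists c => // h h0 hhc _; rewrite addrA; exact: hc.
rewrite subrKC addr0 => /le_trans; apply; rewrite leeD2l// lee_fin.
by rewrite /eta mulrAC ler_pdivrMr ?ltr_pwDr// ler_wpM2l ?lerDl// ltW.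
Qed.
End RateAlongPaths.

(** Both Hamiltonians have this form, with c k p the pairing of p with the jump k; the drift is thus
    the sum of the jumps weighted by their rates. *)
Lemma derive_sum_expR {R : realType} {d : nat} {K : finType} (a : K -> R)
    (c : K -> 'rV[R]_d -> R) (y : 'rV[R]_d) :
  (forall k h, c k (h *: y) = h * c k y) ->
  'D_y (fun p => \sum_k a k * (expR (c k p) - 1)) 0 = \sum_k a k * c k y.
Proof.
move=> clin.
have c0 k : c k 0 = 0 by rewrite -[0](scale0r y) clin mul0r.
pose g (h : R) : R := \sum_k a k * (expR (c k y * h) - 1).
have dg : is_derive (0 : R) 1 g (\sum_k a k * c k y).
  rewrite /g; elim: (index_enum K) => [|k r IH].
    rewrite big_nil (_ : (fun=> _) = cst 0); first exact: is_derive_cst.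
    by apply/funext => h; rewrite big_nil.
  rewrite big_cons (_ : (fun=> _) = (fun h => a k * (expR (c k y * h) - 1)) +
      (fun h => \sum_(k <- r) a k * (expR (c k y * h) - 1))); last first.
    by apply/funext => h; rewrite big_cons.
  apply: is_deriveD; apply: is_derive_eq.
  by rewrite mulr0 expR0 mul1r subr0 [(c k y)%:A]mulr1.
rewrite -(@derive_val _ _ _ _ _ _ _ dg) /derive; congr (lim (_ @ 0^')).
apply/funext => h /=; rewrite /g [h%:A]mulr1 !addr0; congr (h^-1 *: (_ - _)).
  by apply: eq_bigr => k _; rewrite clin [h * _]mulrC.
by apply: eq_bigr => k _; rewrite c0 mulr0.
Qed.

Lemma ereal_sup_cvg0_near {R : realType} (T : Type) (S : nat -> set T)
    (u : nat -> T -> R) (eps : R) :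
  ereal_sup [set (u n x)%:E | x in S n] @[n --> \oo] --> 0%E -> 0 < eps ->
  \forall n \near \oo, forall x, S n x -> u n x <= eps.
Proof.
move=> /fine_cvgP[fin /cvgrPdist_lt cv] eps0; near=> n => x Sx.
have finn : ereal_sup [set (u n x)%:E | x in S n] \is a fin_num by near: n.
rewrite -lee_fin; apply: (@le_trans _ _ (ereal_sup [set (u n x)%:E | x in S n])).
  by apply: ereal_sup_ubound; exists x.
rewrite -(fineK finn) lee_fin; apply/ltW; apply: le_lt_trans (ler_norm _) _.
by rewrite -normrN -sub0r; near: n; exact: cv.
Unshelve. all: by end_near.
Qed.

(** * Generalized Ehrenfest model *)

Section Ehrenfest.
Context {R : realType} {d : nat}.
Variables (rp rm : nat -> 'I_d -> 'rV[R]_d -> R) (vp vm : 'I_d -> 'rV[R]_d -> R).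

Definition ehrenfest_step (k : 'I_d * bool) : 'rV[R]_d :=
  (if k.2 then 2 else -2) *: delta_mx ord0 k.1.

Definition ehrenfest_rho n (k : 'I_d * bool) (x : 'rV[R]_d) : R :=
  if k.2 then (1 - x ord0 k.1) / 2 * rp n k.1 x else (1 + x ord0 k.1) / 2 * rm n k.1 x.

Definition ehrenfest_v (k : 'I_d * bool) (x : 'rV[R]_d) : R :=
  if k.2 then vp k.1 x else vm k.1 x.

Lemma sum_bool (V : nmodType) (F : 'I_d * bool -> V) :
  \sum_k F k = \sum_i (F (i, true) + F (i, false)).
Proof.
rewrite (eq_bigr (fun k => F (k.1, k.2))) => [|[]//].
rewrite -(pair_bigA _ (fun i b => F (i, b)))/=.
by apply: eq_bigr => i _; rewrite big_bool.
Qed.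

Lemma ehrenfest_generatorE n :
  ehrenfest_generator rp rm n = jump_generator ehrenfest_step ehrenfest_rho n.
Proof.
apply/funext => f; apply/funext => x.
rewrite /ehrenfest_generator /jump_generator sum_bool mulr_sumr; apply: eq_bigr => i _.
rewrite /ehrenfest_step /ehrenfest_rho /= !scalerA mulrN scaleNr.
by rewrite [n%:R^-1 * 2]mulrC; ring.
Qed.

Lemma ehrenfest_driftE x :
  drift (ehrenfest_hamiltonian vp vm) x = \sum_k ehrenfest_v k x *: ehrenfest_step k.
Proof.
apply/rowP => i; rewrite mxE.
pose c (k : 'I_d * bool) (p : 'rV[R]_d) : R := (if k.2 then 2 else -2) * p ord0 k.1.
rewrite (_ : ehrenfest_hamiltonian vp vm x =
    fun p => \sum_k ehrenfest_v k x * (expR (c k p) - 1)); last first.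
  apply/funext => p; rewrite sum_bool /c /ehrenfest_v/=.
  by apply: eq_bigr => j _; rewrite mulNr.
rewrite derive_sum_expR; last by move=> k h; rewrite /c !mxE; ring.
have -> : (\sum_k ehrenfest_v k x *: ehrenfest_step k) ord0 i =
    \sum_k (ehrenfest_v k x *: ehrenfest_step k) ord0 i by exact: summxE.
by apply: eq_bigr => k _; rewrite /c /ehrenfest_step !mxE eq_sym.
Qed.

Hypothesis rates : ehrenfest_rates rp rm vp vm.

Lemma cube_compact : compact (@cube R d).
Proof.
have -> : @cube R d = [set x | forall i, `[(-1 : R), 1]%classic (x ord0 i)].
  by apply/seteqP; split => x /= h i; have := h i; rewrite /= in_itv.
by apply: (@rV_compact _ _ (fun=> `[(-1 : R), 1]%classic)) => i; exact: segment_compact.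
Qed.

Lemma cube_grid_finite n : finite_set (@cube_grid R d n).
Proof.
pose f (s : {ffun 'I_d -> 'I_n.+1}) : 'rV[R]_d :=
  \row_i (-1 + (s i)%:R * (2 / n%:R)).
apply: (@sub_finite_set _ _ [set f s | s in setT]); last first.
  by apply: finite_image; exact: finite_finset.
move=> x [_ hx]; have /choice[k hk] i : exists k : 'I_n.+1, x ord0 i = -1 + k%:R * (2 / n%:R).
  by have [k kn ->] := hx i; exists (Ordinal (kn : (k < n.+1)%N)).
exists [ffun i => k i] => //; apply/rowP => i; by rewrite mxE ffunE hk.
Qed.

Lemma cube_gridP n (x : 'rV[R]_d) : (0 < n)%N ->
  (forall i, exists2 k : nat, (k <= n)%N & x ord0 i = -1 + k%:R * (2 / n%:R)) ->
  @cube_grid R d n x.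
Proof.
move=> n0 hx; split=> // i; have [k kn ->] := hx i.
have nR0 : (0 : R) < n%:R by rewrite ltr0n.
have h0 : 0 <= k%:R * (2 / n%:R) :> R by rewrite mulr_ge0// divr_ge0.
rewrite lerDl h0/= -lerBrDl mulrA ler_pdivrMr//.
by rewrite (_ : (1 - -1) * n%:R = n%:R * 2) ?ler_wpM2r ?ler_nat//; ring.
Qed.

Lemma ehrenfest_jump_model :
  jump_model cube cube_grid ehrenfest_step ehrenfest_rho ehrenfest_v.
Proof.
split.
- by move=> n _; exact: cube_grid_finite.
- by move=> n _ x [].
- move=> n [i b] x n0 nx; have [rp0 rm0] := ehrenfest_r_ge0 rates i n0 nx.
  have [/(_ i)/andP[x1 x2] _] := nx.
  by rewrite /ehrenfest_rho/=; case: ifP => _; rewrite mulr_ge0// divr_ge0//; lra.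
- move=> n [i b] x n0 [_ hx]; rewrite /ehrenfest_rho/= => rho0.
  have nR : (n%:R : R) != 0 by rewrite pnatr_eq0 -lt0n.
  apply: cube_gridP => // j; have [k kn xk] := hx j; rewrite !mxE/=.
  have [ji|_] := eqVneq j i; last by exists k; rewrite // !mulr0 addr0.
  subst j; case: b rho0 => rho0.
    have kltn : (k < n)%N.
      rewrite ltn_neqAle kn andbT; apply: contraTneq rho0 => kn'.
      have -> : x ord0 i = 1 by rewrite xk kn'; field.
      by rewrite subrr !mul0r ltxx.
    exists k.+1 => //; rewrite xk -[k.+1%:R]natr1 (_ : true%:R = 1 :> R)//; by field.
  have k0 : (0 < k)%N.
    rewrite lt0n; apply: contraTneq rho0 => k0.
    by rewrite xk k0 mul0r addr0 subrr !mul0r ltxx.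
  exists k.-1; first exact: leq_trans (leq_pred _) kn.
  rewrite xk -{1}(prednK k0) -[k.-1.+1%:R]natr1 (_ : true%:R = 1 :> R)//; by field.
- move=> [i b] x Ex; have [] := ehrenfest_v_ge0 rates i Ex.
  by rewrite /ehrenfest_v/=; case: b.
- exact: cube_compact.
- move=> [i b]; have [] := ehrenfest_v_continuous rates i.
  by rewrite /ehrenfest_v/=; case: b.
- move=> [i b] eps eps0; have := ereal_sup_cvg0_near (ehrenfest_cvg rates) eps0.
  apply: filterS => n h x nx; apply: le_trans (h x nx).
  rewrite (bigD1 i)//= /ehrenfest_rho /ehrenfest_v /=.
  apply: le_trans (_ : `|(1 - x ord0 i) / 2 * rp n i x - vp i x| +
    `|(1 + x ord0 i) / 2 * rm n i x - vm i x| <= _).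
    by case: b; rewrite ?lerDl ?lerDr.
  by rewrite lerDl sumr_ge0// => j _; rewrite addr_ge0.
Qed.
End Ehrenfest.

(** * Decay in the Ehrenfest model *)

Section EhrenfestDecay.
Context {R : realType} {d : nat}.
Variables (rp rm : nat -> 'I_d -> 'rV[R]_d -> R) (vp vm : 'I_d -> 'rV[R]_d -> R).
Hypothesis rates : ehrenfest_rates rp rm vp vm.
Variable x : R -> 'rV[R]_d.
Hypothesis x_sol : solution cube (drift (ehrenfest_hamiltonian vp vm)) x.

Lemma ehrenfest_step_sum (w : 'I_d * bool -> R) i :
  (\sum_k w k *: ehrenfest_step k) ord0 i = 2 * (w (i, true) - w (i, false)) :> R.
Proof.
have -> : (\sum_k w k *: ehrenfest_step k) ord0 i =
    \sum_k (w k *: ehrenfest_step k) ord0 i by exact: summxE.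
rewrite sum_bool (bigD1 i)//= big1 => [|j ji].
  by rewrite !mxE !eqxx/=; ring.
by rewrite !mxE/= eq_sym (negbTE ji) !mulr0 addr0.
Qed.

Lemma ehrenfest_drift_coord y i :
  drift (ehrenfest_hamiltonian vp vm) y ord0 i = 2 * (vp i y - vm i y).
Proof. by rewrite ehrenfest_driftE ehrenfest_step_sum. Qed.

(** A rate that vanishes at x s is identically 0, or the coordinate sits on the face where that rate
    may vanish. It cannot sit on both faces, so at least one rate is identically 0 and the
    coordinate is monotone; if only one is, the face blocks the remaining direction. *)
Lemma ehrenfest_frozen s t i : 0 <= s -> s <= t ->
  vp i (x s) = 0 -> vm i (x s) = 0 -> x t ord0 i = x s ord0 i.
Proof.
move=> s0 st vp0 vm0.
have rx := solution_coord x_sol i.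
have Ex u : 0 <= u -> cube (x u) by exact: (solution_in x_sol).
have xt := Ex t (le_trans s0 st) i.
have v0 u : s <= u -> 0 <= vp i (x u) /\ 0 <= vm i (x u).
  by move=> su; apply: (ehrenfest_v_ge0 rates); apply: Ex; exact: le_trans su.
have decr : vanishes_on cube (vp i) -> x t ord0 i <= x s ord0 i.
  move=> hp; apply: (right_primitive_le rx) => // u su _.
  rewrite ehrenfest_drift_coord hp; last by apply: Ex; exact: le_trans su.
  by have [_] := v0 u su; lra.
have incr : vanishes_on cube (vm i) -> x s ord0 i <= x t ord0 i.
  move=> hm; apply: (right_primitive_ge rx) => // u su _.
  rewrite ehrenfest_drift_coord hm; last by apply: Ex; exact: le_trans su.
  by have [] := v0 u su; lra.
have xs1 : (forall y, cube y -> y ord0 i != 1 -> 0 < vp i y) -> x s ord0 i = 1.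
  move=> hp; apply/eqP; apply: contraT => /(hp _ (Ex s s0)).
  by rewrite vp0 ltxx.
have xsN1 : (forall y, cube y -> y ord0 i != -1 -> 0 < vm i y) -> x s ord0 i = -1.
  move=> hm; apply/eqP; apply: contraT => /(hm _ (Ex s s0)).
  by rewrite vm0 ltxx.
have [hp|[hp _]] := ehrenfest_vp rates i; have [hm|[hm _]] := ehrenfest_vm rates i.
- by apply: le_anti; rewrite decr// incr.
- by have := decr hp; have := xsN1 hm; lra.
- by have := incr hm; have := xs1 hp; lra.
- by have := xsN1 hm; have := xs1 hp; lra.
Qed.

Variable nu : nat -> probability (borel 'rV[R]_d) R.
Hypothesis nu_inv : forall n, (0 < n)%N ->
  invariant_measure (cube_grid n) (ehrenfest_generator rp rm n) (nu n).
Variable I0 : 'rV[R]_d -> \bar R.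
Hypothesis I0_LDP : LDP cube nu I0.

Lemma ehrenfest_decay s t : 0 <= s -> s <= t -> (I0 (x t) <= I0 (x s))%E.
Proof.
have model := ehrenfest_jump_model rates.
have inv n : (0 < n)%N -> invariant_measure (cube_grid n)
    (jump_generator ehrenfest_step (ehrenfest_rho rp rm) n) (nu n).
  by move=> n0; rewrite -ehrenfest_generatorE; exact: nu_inv.
apply: (rate_solution_le I0_LDP x_sol) => {}s eta s0 eta0.
set z := x s.
have Ez : cube z by exact: (solution_in x_sol).
have v0 k : 0 <= ehrenfest_v vp vm k z by exact: (jump_v_ge0 model).
have vp0 i : 0 <= vp i z by have := v0 (i, true).
have vm0 i : 0 <= vm i z by have := v0 (i, false).
have [c c0 hc] := rate_local_le model inv I0_LDP Ez v0 (fun k => id) eta0.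
(* [eps] lies below every positive rate at z, so that the corrected intensities [w'] stay
   nonnegative. *)
have : \forall eps \near 0^'+, 0 < eps /\ eps < c /\ forall i : 'I_d,
    (0 < vp i z -> eps < vp i z) /\ (0 < vm i z -> eps < vm i z).
  near=> eps; split=> //; split; first by near: eps; exact: nbhs_right_lt.
  near: eps; apply: filter_forall => i.
  have pos_near (a : R) : \forall eps \near 0^'+, 0 < a -> eps < a.
    have [a0|a0] := ltP 0 a; last by near=> eps.
    by near=> eps => _; near: eps; exact: nbhs_right_lt.
  by apply: filterS2 (pos_near (vp i z)) (pos_near (vm i z)) => eps h1 h2.
move=> /filter_ex[eps [eps0 [epsc hv]]].
have [h0 h00 hh0] := solution_right_derive x_sol s0 eps0.
exists (Num.min c h0); first by rewrite lt_min c0.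
move=> h hpos; rewrite lt_min => /andP[hltc hlth0].
pose D : 'rV[R]_d := h^-1 *: (x (s + h) - z).
have DF i : `|D ord0 i - 2 * (vp i z - vm i z)| < eps.
  rewrite -ehrenfest_drift_coord.
  have := coord_le_norm (D - drift (ehrenfest_hamiltonian vp vm) z) i.
  by rewrite !mxE => /le_lt_trans; apply; have := hh0 h hpos hlth0; rewrite -/z -/D.
(* The flux of the solution may use a jump whose rate is 0 at z, so the net increment is attributed
   to jumps of positive rate instead: the upward jump takes the whole correction if it can,
   otherwise the downward jump carries the increment alone, and if both rates vanish the coordinate
   is frozen. *)
pose w' (k : 'I_d * bool) : R := let i := k.1 in
  if 0 < vp i z then (if k.2 then D ord0 i / 2 + vm i z else vm i z)
  else if 0 < vm i z then (if k.2 then 0 else - D ord0 i / 2) else 0.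
have w'D : \sum_k w' k *: ehrenfest_step k = D.
  apply/rowP => i; rewrite ehrenfest_step_sum /w'/=.
  case: ifPn => [_|vpi]; first by lra.
  case: ifPn => [_|vmi]; first by lra.
  rewrite subrr mulr0 /D !mxE (@ehrenfest_frozen s (s + h) i)//.
  - by rewrite subrr mulr0.
  - by rewrite lerDl ltW.
  - by apply/eqP; rewrite eq_le vp0 leNgt vpi.
  - by apply/eqP; rewrite eq_le vm0 leNgt vmi.
have xE : z + h *: \sum_k w' k *: ehrenfest_step k = x (s + h).
  by rewrite w'D /D scalerA divff ?gt_eqF// scale1r subrKC.
have cost0 : \sum_k entropy_cost (ehrenfest_v vp vm k z) (ehrenfest_v vp vm k z) = 0.
  rewrite big1// => k _; rewrite /entropy_cost.
  have [->|vn] := eqVneq (ehrenfest_v vp vm k z) 0; first by rewrite mul0r subr0 addr0.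
  by rewrite divff// ln1 mulr0 sub0r addNr.
have := hc h w' hpos hltc; rewrite xE cost0 add0r mulrC; apply.
- move=> [i b]; rewrite /w'/=; have := DF i; rewrite ltr_norml => /andP[D1 D2].
  have [h1 h2] := hv i; have vmi0 := vm0 i.
  case: ifPn => [/h1 vpi|vpi]; first by case: b; lra.
  have vpz : vp i z = 0 by apply/eqP; rewrite eq_le vp0 leNgt vpi.
  by case: ifPn => // /h2 vmi; case: b => //; lra.
- move=> [i b]; apply: lt_trans epsc; rewrite /w' /ehrenfest_v/=.
  have := DF i; rewrite !ltr_norml => /andP[D1 D2].
  case: ifPn => [vpi|vpi].
    by case: b; apply/andP; split; lra.
  have vpz : vp i z = 0 by apply/eqP; rewrite eq_le vp0 leNgt vpi.
  case: ifPn => [vmi|vmi]; first by case: b; apply/andP; split; lra.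
  have vmz : vm i z = 0 by apply/eqP; rewrite eq_le vm0 leNgt vmi.
  by case: b; rewrite ?vpz ?vmz subrr oppr_lt0 eps0.
- move=> [i b]; rewrite /w' /ehrenfest_v/=.
  case: ifPn => [vpi|_]; first by case: b.
  by case: ifPn => // vmi; case: b => //; rewrite ltxx.
- by apply: (solution_in x_sol); rewrite addr_ge0// ltW.
Unshelve. all: by end_near.
Qed.
End EhrenfestDecay.

Lemma norm_le_coord {R : realType} {d : nat} (y : 'rV[R]_d) (c : R) :
  0 <= c -> (forall i, `|y ord0 i| <= c) -> `|y| <= c.
Proof.
move=> c0 h; rewrite /Num.norm/=.
have [->//|] := eqVneq (mx_norm y) 0; move=> /mx_norm_neq0[[i j] ->]/=.
by rewrite (ord1 i).
Qed.

(** * Glauber model *)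

Section Glauber.
Context {R : realType} {d : nat}.
Variables (r : nat -> 'I_d -> 'I_d -> 'rV[R]_d -> R) (v : 'I_d -> 'I_d -> 'rV[R]_d -> R).

Definition glauber_step (k : 'I_d * 'I_d) : 'rV[R]_d :=
  delta_mx ord0 k.2 - delta_mx ord0 k.1.

Definition glauber_rho n (k : 'I_d * 'I_d) (mu : 'rV[R]_d) : R :=
  mu ord0 k.1 * r n k.1 k.2 mu.

Lemma glauber_generatorE n :
  glauber_generator r n = jump_generator glauber_step glauber_rho n.
Proof.
apply/funext => f; apply/funext => mu.
rewrite /glauber_generator /jump_generator pair_bigA; congr (_ * _).
apply: eq_bigr => -[a b] _; rewrite /glauber_rho /glauber_step/=.
by rewrite scalerBr -addrA [- _ + _]addrC.
Qed.

Lemma glauber_driftE x :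
  drift (glauber_hamiltonian v) x = \sum_k v k.1 k.2 x *: glauber_step k.
Proof.
apply/rowP => i; rewrite mxE.
pose c (k : 'I_d * 'I_d) (p : 'rV[R]_d) : R := p ord0 k.2 - p ord0 k.1.
rewrite (_ : glauber_hamiltonian v x =
    fun p => \sum_k v k.1 k.2 x * (expR (c k p) - 1)); last first.
  by apply/funext => p; rewrite /glauber_hamiltonian pair_bigA.
rewrite derive_sum_expR; last by move=> k h; rewrite /c !mxE; ring.
have -> : (\sum_k v k.1 k.2 x *: glauber_step k) ord0 i =
    \sum_k (v k.1 k.2 x *: glauber_step k) ord0 i by exact: summxE.
by apply: eq_bigr => k _; rewrite /c /glauber_step !mxE !eqxx /= ![i == _]eq_sym.
Qed.

Lemma sum_delta (i : 'I_d) :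
  \sum_(c < d) (delta_mx ord0 i : 'rV[R]_d) ord0 c = 1.
Proof.
rewrite (bigD1 i)//= big1 => [|c ci]; first by rewrite mxE !eqxx addr0.
by rewrite mxE/= (negbTE ci).
Qed.

Lemma simplex_compact : compact (@simplex R d).
Proof.
apply: (@subclosed_compact 'rV[R]_d _ [set x : 'rV[R]_d | forall i, `[(0 : R), 1]%classic (x ord0 i)]).
- rewrite (_ : simplex = (\bigcap_(i in [set: 'I_d]) [set mu | 0 <= mu ord0 i]) `&`
    [set mu | \sum_(i < d) mu ord0 i = 1]); last first.
    by apply/seteqP; split=> mu [h1 h2]; split=> // i; [move=> _; exact: h1|exact: h1].
  apply: closedI.
    apply: closed_bigI => i _.
    apply: (@closed_comp _ _ (fun mu : 'rV[R]_d => mu ord0 i) [set t | 0 <= t]).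
      by move=> mu _; exact: coord_continuous.
    exact: closed_ge.
  apply: (@closed_comp _ _ (fun mu : 'rV[R]_d => \sum_(i < d) mu ord0 i) [set 1]).
    move=> mu _; apply: cvg_big => [||i _]; [exact: add_continuous|exact: nbhs_filter|exact: coord_continuous].
  exact: closed_eq.
- by apply: (@rV_compact _ _ (fun=> `[(0 : R), 1]%classic)) => i; exact: segment_compact.
- move=> mu [mu0 mu1] i /=; rewrite in_itv/= mu0/= -mu1.
  by rewrite (bigD1 i)//= lerDl sumr_ge0.
Qed.

Lemma simplex_move z a b tau : simplex z -> 0 <= tau -> tau <= z ord0 a ->
  simplex (z + tau *: glauber_step (a, b)).
Proof.
move=> [z0 z1] tau0 taua; split=> [i|].
  rewrite !mxE/=; have [->|ia] := eqVneq i a.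
    by case: (a == b); rewrite /=; lra.
  by case: (i == b); have := z0 i; rewrite /=; lra.
under eq_bigr do rewrite mxE.
rewrite big_split/= z1.
have E c : (tau *: glauber_step (a, b)) ord0 c = tau *
    ((delta_mx ord0 b : 'rV[R]_d) ord0 c - (delta_mx ord0 a : 'rV[R]_d) ord0 c).
  by rewrite !mxE.
under eq_bigr do rewrite E.
by rewrite -mulr_sumr sumrB !sum_delta// subrr mulr0 addr0.
Qed.

Lemma empirical_simplex n : (0 < n)%N -> @empirical R d n `<=` simplex.
Proof.
move=> n0 _ [s ->]; have nR : (n%:R : R) != 0 by rewrite pnatr_eq0 -lt0n.
have sE i : (\sum_(k < n) delta_mx ord0 (s k) : 'rV[R]_d) ord0 i =
    \sum_(k < n) (delta_mx ord0 (s k) : 'rV[R]_d) ord0 i by exact: summxE.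
split=> [i|].
  rewrite mxE sE mulr_ge0 ?invr_ge0// sumr_ge0// => k _.
  by rewrite mxE.
under eq_bigr do rewrite mxE sE.
rewrite -mulr_sumr exchange_big/=.
under eq_bigr do rewrite sum_delta//.
by rewrite sumr_const card_ord mulVf.
Qed.

Lemma empirical_finite n : finite_set (@empirical R d n).
Proof.
pose f (s : {ffun 'I_n -> 'I_d}) : 'rV[R]_d := n%:R^-1 *: \sum_(k < n) delta_mx ord0 (s k).
apply: (@sub_finite_set _ _ [set f s | s in setT]); last first.
  by apply: finite_image; exact: finite_finset.
move=> _ [s ->]; exists [ffun k => s k] => //; rewrite /f; congr (_ *: _).
by apply: eq_bigr => k _; rewrite ffunE.
Qed.

Lemma empirical_counts n (c : 'I_d -> nat) : (\sum_i c i)%N = n ->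
  empirical n (n%:R^-1 *: \row_i (c i)%:R : 'rV[R]_d).
Proof.
move=> cn; pose l := flatten [seq nseq (c i) i | i <- enum 'I_d].
have ln : size l = n.
  by rewrite size_flatten /shape -map_comp sumnE big_map big_enum/= -cn;
    apply: eq_bigr => i _; rewrite size_nseq.
rewrite -ln; exists (tnth (in_tuple l)); congr (_ *: _).
rewrite -(big_tnth _ _ l xpredT (fun i => delta_mx ord0 i)) big_flatten/= big_map big_enum/=.
apply/rowP => j; rewrite mxE.
have -> (F : 'I_d -> 'rV[R]_d) : (\sum_i F i) ord0 j = \sum_i F i ord0 j by exact: summxE.
under eq_bigr do rewrite big_nseq iter_addr addr0 mulmxnE mxE.
rewrite (bigD1 j)//= big1 => [|i ij]; first by rewrite !eqxx addr0.
by rewrite [j == i]eq_sym (negbTE ij) ?andbF mulr0n mul0rn.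
Qed.
End Glauber.

(** The logarithm is controlled by a multiplicative bound of w by v, the linear part by an additive
    bound of v by w. Near a zero of a coordinate, the monotone factor of the rates yields exactly
    such one-sided bounds. *)
Lemma entropy_cost_le {R : realType} (w v C eta : R) :
  0 <= w -> 0 <= v -> w <= C -> 0 <= eta ->
  w <= (1 + eta) * v -> v - w <= eta -> entropy_cost w v <= (C + 1) * eta.
Proof.
move=> w0 v0 wC eta0 wv vw; rewrite /entropy_cost.
have [w_0|wn] := eqVneq w 0.
  rewrite w_0 in vw *; have : 0 <= C * eta by rewrite mulr_ge0// -w_0.
  by rewrite mul0r; lra.
have wp : 0 < w by rewrite lt_neqAle eq_sym wn.
have vp : 0 < v.
  rewrite lt_neqAle v0 andbT; apply: contraTneq wv => <-.
  by rewrite mulr0 -ltNge.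
have : w * ln (w / v) <= C * eta.
  apply: le_trans (_ : w * eta <= _); last by rewrite ler_wpM2r.
  rewrite ler_wpM2l//; apply: le_trans (ln_le_subr1 _) _; first by rewrite divr_gt0.
  by rewrite lerBlDl ler_pdivrMr.
lra.
Qed.


(** * Decay in the Glauber model *)

Section GlauberDecay.
Context {R : realType} {d : nat}.
Variables (r : nat -> 'I_d -> 'I_d -> 'rV[R]_d -> R) (v : 'I_d -> 'I_d -> 'rV[R]_d -> R).
Hypothesis rates : glauber_rates r v.

Lemma simplex_ex_gt0 (z : 'rV[R]_d) : simplex z -> exists i, 0 < z ord0 i.
Proof.
move=> [z0 z1]; apply: contrapT => /forallNP h.
have : \sum_(i < d) z ord0 i = 0.
  by rewrite big1// => i _; apply/eqP; rewrite eq_le z0 leNgt andbT; apply/negP.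
by rewrite z1 => /eqP; rewrite oner_eq0.
Qed.

(** The coordinates of n z are rounded down and the missing particles are given to a state charged
    by z, so no uncharged state becomes charged. *)
Lemma empirical_dense (z : 'rV[R]_d) (eps : R) : simplex z -> 0 < eps ->
  \forall n \near \oo, exists2 y, empirical n y &
    `|z - y| <= eps /\ forall a, z ord0 a = 0 -> y ord0 a = 0.
Proof.
move=> Ez eps0; have [z0 z1] := Ez; have [j zj] := simplex_ex_gt0 Ez.
near=> n.
have n0 : (0 < n)%N by near: n; exact: nbhs_infty_gt.
have nR0 : (0 : R) < n%:R by rewrite ltr0n.
pose t i := Num.trunc (n%:R * z ord0 i).
have tP i : (t i)%:R <= n%:R * z ord0 i < (t i).+1%:R.
  by apply: truncn_itv; rewrite mulr_ge0.
have tn : (\sum_(i | i != j) t i <= n)%N.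
  rewrite -(ler_nat R) natr_sum; apply: le_trans (_ : \sum_(i | i != j) n%:R * z ord0 i <= _).
    by apply: ler_sum => i _; have /andP[] := tP i.
  rewrite -mulr_sumr ler_piMr// -z1 [leRHS](bigD1 j)//= lerDr; exact: z0.
pose c i := if i == j then (n - \sum_(i | i != j) t i)%N else t i.
have cn : (\sum_i c i)%N = n.
  rewrite (bigD1 j)//= {1}/c eqxx (eq_bigr t) ?subnK// => i ij.
  by rewrite /c (negbTE ij).
exists (n%:R^-1 *: \row_i (c i)%:R); first exact: empirical_counts.
have ti i : `|z ord0 i - n%:R^-1 * (t i)%:R| <= n%:R^-1.
  have -> : z ord0 i - n%:R^-1 * (t i)%:R = n%:R^-1 * (n%:R * z ord0 i - (t i)%:R).
    by field; rewrite gt_eqF.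
  rewrite normrM gtr0_norm ?invr_gt0// ler_piMr ?invr_ge0// ler_norml.
  by have := tP i; rewrite -natr1 => /andP[h1 h2]; apply/andP; split; lra.
have dn : d%:R * n%:R^-1 <= eps.
  by rewrite ler_pdivrMr// mulrC -ler_pdivrMr//; near: n; exact: nbhs_infty_ger.
split; last first.
  move=> a za; rewrite !mxE /c; case: eqVneq => [aj|_].
    by rewrite -aj za ltxx in zj.
  by rewrite /t za mulr0 truncn0 mulr0.
apply: norm_le_coord => [|i]; first exact: ltW.
apply: le_trans dn; rewrite !mxE /c; case: eqVneq => [->|_]; last first.
  apply: le_trans (ti i) _; rewrite ler_peMl ?invr_ge0// ler1n.
  exact: leq_ltn_trans (leq0n i) (ltn_ord i).
rewrite natrB// natr_sum.
have -> : z ord0 j = 1 - \sum_(i | i != j) z ord0 i.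
  by rewrite -z1 (bigD1 j)//= addrK.
have -> : 1 - \sum_(i | i != j) z ord0 i - n%:R^-1 * (n%:R - \sum_(i | i != j) (t i)%:R) =
    - \sum_(i | i != j) (z ord0 i - n%:R^-1 * (t i)%:R).
  rewrite sumrB -mulr_sumr mulrBr mulVf ?gt_eqF//; ring.
rewrite normrN; apply: le_trans (ler_norm_sum _ _ _) _.
apply: le_trans (_ : \sum_(i | i != j) n%:R^-1 <= _); first exact: ler_sum.
rewrite sumr_const -[leLHS]mulr_natl ler_wpM2r ?invr_ge0// ler_nat.
by rewrite (leq_trans (max_card _))// card_ord.
Unshelve. all: by end_near.
Qed.

(** At empirical measures that do not charge a, the product mu a * r n is exactly 0; such measures
    approach z by [empirical_dense], and uniform convergence together with the continuity of v
    transfers this to the limit. *)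
Lemma glauber_v_eq0 a b z : simplex z -> z ord0 a = 0 -> v a b z = 0.
Proof.
move=> Ez za; apply/eqP; rewrite -normr_le0; apply/ler_addgt0Pr => eps eps0; rewrite add0r.
have e20 : 0 < eps / 2 by rewrite divr_gt0.
have cv : {within simplex, continuous (v a b)} by exact: (glauber_v_continuous rates).
have [c c0 hc] := within_continuous_norm cv Ez e20.
have c20 : 0 < c / 2 by rewrite divr_gt0.
have : \forall n \near \oo, (0 < n)%N /\
    (forall mu, empirical n mu -> `|mu ord0 a * r n a b mu - v a b mu| <= eps / 2) /\
    (exists2 y, empirical n y & `|z - y| <= c / 2 /\ forall a, z ord0 a = 0 -> y ord0 a = 0).
  near=> n; split; first by near: n; exact: nbhs_infty_gt.
  split; near: n; last exact: empirical_dense.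
  exact: ereal_sup_cvg0_near (glauber_cvg rates a b) e20.
move=> /filter_ex[n [n0 [hv [y ny [zy y0]]]]].
have := hv y ny; rewrite y0// mul0r sub0r normrN => vy.
have : `|v a b z - v a b y| < eps / 2.
  apply: hc; first exact: (empirical_simplex n0).
  by apply: le_lt_trans zy _; rewrite ltr_pdivrMr//; lra.
move=> vzy; rewrite -(subrK (v a b y) (v a b z)) [leRHS]splitr.
by apply: le_trans (ler_normD _ _) _; rewrite lerD// ltW.
Unshelve. all: by end_near.
Qed.

Lemma glauber_jump_model :
  jump_model simplex empirical (@glauber_step R d) (glauber_rho r) (fun k => v k.1 k.2).
Proof.
split.
- by move=> n _; exact: empirical_finite.
- by move=> n; exact: empirical_simplex.
- move=> n [a b] x n0 nx; rewrite /glauber_rho mulr_ge0//.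
    by have [] := empirical_simplex n0 nx.
  exact: (glauber_r_ge0 rates).
- move=> n [a b] x n0 [s ->]; rewrite /glauber_rho /= => rho0.
  (* A positive rate means that some particle is in state a; the jump moves that particle to b. *)
  have [k0 sk0] : exists k, s k = a.
    apply: contrapT => /forallNP sa; move: rho0; rewrite mxE.
    have -> : (\sum_(k < n) delta_mx ord0 (s k) : 'rV[R]_d) ord0 a =
      \sum_(k < n) (delta_mx ord0 (s k) : 'rV[R]_d) ord0 a by exact: summxE.
    rewrite big1 ?mulr0 ?mul0r ?ltxx// => k _; rewrite mxE eqxx/=.
    by case: eqVneq => // /esym/sa.
  exists (fun k => if k == k0 then b else s k).
  rewrite -scalerDr; congr (_ *: _); rewrite [in RHS](bigD1 k0)//= eqxx (bigD1 k0)//= sk0.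
  rewrite /glauber_step/= [X in _ = _ + X](eq_bigr (fun k => delta_mx ord0 (s k))).
    by rewrite [LHS]addrC [LHS]addrA subrK.
  by move=> k /negbTE ->.
- by move=> [a b] x Ex; exact: (glauber_v_ge0 rates).
- exact: simplex_compact.
- by move=> [a b]; apply: (glauber_v_continuous rates).
- by move=> [a b] eps eps0; exact: ereal_sup_cvg0_near (glauber_cvg rates a b) eps0.
Qed.

(** The edges of the transition graph: by the next two lemmas, on the simplex [v a b] is positive
    exactly where (a, b) is active and a is charged. *)
Let active a b := ~ vanishes_on simplex (v a b).

Lemma glauber_v_gt0 a b z : simplex z -> 0 < v a b z -> active a b /\ 0 < z ord0 a.
Proof.
move=> Ez vz; split; first by move=> /(_ z Ez) v0; rewrite v0 ltxx in vz.
have [z0 _] := Ez; rewrite lt_neqAle z0 andbT; apply: contraTneq vz => za.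
by rewrite (glauber_v_eq0 b Ez (esym za)) ?ltxx.
Qed.

Lemma glauber_active_gt0 a b z : simplex z -> active a b -> 0 < z ord0 a -> 0 < v a b z.
Proof. by move=> Ez ab za; have [//|[h _]] := glauber_v rates a b; exact: h. Qed.

(* Near a zero of the a-th coordinate the monotone factor makes v a b nearly
   nondecreasing in that coordinate. *)
Lemma glauber_v_compare (z : 'rV[R]_d) (eta : R) : simplex z -> 0 < eta ->
  exists2 c : R, 0 < c & forall a b X Y, simplex X -> simplex Y ->
    `|z - X| < c -> `|z - Y| < c ->
    v a b Y - v a b X <= eta /\ v a b X <= v a b z + eta /\
    ((z ord0 a = 0 -> X ord0 a <= Y ord0 a) -> v a b X <= (1 + eta) * v a b Y).
Proof.
move=> Ez eta0.
suff h a b : \forall c \near 0^'+, forall X Y, simplex X -> simplex Y ->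
    `|z - X| < c -> `|z - Y| < c ->
    v a b Y - v a b X <= eta /\ v a b X <= v a b z + eta /\
    ((z ord0 a = 0 -> X ord0 a <= Y ord0 a) -> v a b X <= (1 + eta) * v a b Y).
  have : \forall c \near 0^'+, 0 < c /\ forall a b X Y, simplex X -> simplex Y ->
      `|z - X| < c -> `|z - Y| < c ->
      v a b Y - v a b X <= eta /\ v a b X <= v a b z + eta /\
      ((z ord0 a = 0 -> X ord0 a <= Y ord0 a) -> v a b X <= (1 + eta) * v a b Y).
    near=> c; split=> //; near: c; apply: filter_forall => a; exact: filter_forall.
  by move=> /filter_ex[c [c0 hc]]; exists c.
have cv : {within simplex, continuous (v a b)} by exact: (glauber_v_continuous rates).
have e20 : 0 < eta / 2 by rewrite divr_gt0.
have [c0 c00 hc0] := within_continuous_norm cv Ez e20.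
have near_c0 : \forall c \near 0^'+, c < c0 by exact: nbhs_right_lt.
suff h : \forall c \near 0^'+, forall X Y, simplex X -> simplex Y ->
    `|z - X| < c -> `|z - Y| < c ->
    (z ord0 a = 0 -> X ord0 a <= Y ord0 a) -> v a b X <= (1 + eta) * v a b Y.
  apply: filterS2 near_c0 h => c cc0 h X Y EX EY zX zY.
  have := hc0 X EX (lt_trans zX cc0); have := hc0 Y EY (lt_trans zY cc0).
  rewrite !ltr_norml => /andP[h1 h2] /andP[h3 h4].
  by split; [lra|split; [lra|exact: h]].
have [v0|[vpos vfac]] := glauber_v rates a b.
  by near=> c => X Y EX EY _ _ _; rewrite !v0 ?mulr0.
have vge0 X : simplex X -> 0 <= v a b X by exact: (glauber_v_ge0 rates).
have eta2 : 0 < 2 + eta by rewrite addr_gt0.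
(* The tolerance e solves p + e = (1 + eta) * (p - e). *)
have ratio (p q1 q2 : R) : 0 < p -> `|p - q1| < eta * p / (2 + eta) ->
    `|p - q2| < eta * p / (2 + eta) -> q1 <= (1 + eta) * q2.
  move=> p0; set e := _ / _ => h1 h2.
  have eE : e * (2 + eta) = eta * p by rewrite /e divfK ?gt_eqF.
  move: h1 h2; rewrite !ltr_norml => /andP[h1 h2] /andP[h3 h4].
  apply: le_trans (_ : p + e <= _); first by lra.
  apply: le_trans (_ : (1 + eta) * (p - e) <= _); first by lra.
  by rewrite ler_wpM2l//; lra.
have [za|za] := eqVneq (z ord0 a) 0; last first.
  have vz : 0 < v a b z.
    by apply: vpos => //; rewrite lt_neqAle eq_sym za; have [-> _] := Ez.
  have e0 : 0 < eta * v a b z / (2 + eta) by rewrite divr_gt0// mulr_gt0.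
  have [c1 c10 hc1] := within_continuous_norm cv Ez e0.
  near=> c => X Y EX EY zX zY _; have cc1 : c < c1 by near: c; exact: nbhs_right_lt.
  by apply: (ratio (v a b z)) => //; apply: hc1 => //; exact: lt_trans cc1.
have [U [g [k [zU gmono kcont kz vE]]]] := vfac z Ez za.
(* Since v vanishes at z and the continuous factor does not, the monotone factor vanishes at 0,
   hence is nonnegative on [0, 1]. *)
have g0 : g 0 = 0.
  have := vE z Ez (nbhs_singleton zU); rewrite (glauber_v_eq0 b Ez za) za.
  by move/esym/eqP; rewrite mulf_eq0 (negbTE kz) orbF => /eqP.
have simplex01 (X : 'rV[R]_d) : simplex X -> X ord0 a \in `[0, 1].
  move=> [X0 X1]; rewrite in_itv/= X0/= -X1 (bigD1 a)//= lerDl.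
  exact: sumr_ge0.
have in00 : (0 : R) \in `[0, 1] by rewrite in_itv/= lexx ler01.
have ge0 X : simplex X -> 0 <= g (X ord0 a).
  move=> EX; rewrite -g0; apply: gmono => //; first exact: simplex01.
  by have [-> _] := EX.
have e0 : 0 < eta * `|k z| / (2 + eta) by rewrite divr_gt0// mulr_gt0// normr_gt0.
have elt : eta * `|k z| / (2 + eta) < `|k z|.
  by rewrite ltr_pdivrMr// mulrC ltr_pM2l ?normr_gt0//; lra.
have [c1 c10 hc1] := within_continuous_norm kcont (conj Ez (nbhs_singleton zU)) e0.
have [c2 /= c20 hc2] := (nbhs_ballP _ _).1 zU.
near=> c => X Y EX EY zX zY XY.
have cc1 : c < c1 by near: c; exact: nbhs_right_lt.
have cc2 : c < c2 by near: c; exact: nbhs_right_lt.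
have UX : U X by apply: hc2; rewrite -ball_normE /=; exact: lt_trans cc2.
have UY : U Y by apply: hc2; rewrite -ball_normE /=; exact: lt_trans cc2.
have kX := hc1 X (conj EX UX) (lt_trans zX cc1).
have kY := hc1 Y (conj EY UY) (lt_trans zY cc1).
(* A negative continuous factor makes [v a b X] nonpositive near z, and the bound is trivial. *)
have [k0|k0] := ltP (k z) 0.
  have kX0 : k X < 0.
    move: kX elt; rewrite (ltr0_norm k0) ltr_norml => /andP[h1 h2] h3; lra.
  apply: le_trans (_ : 0 <= _); last by rewrite mulr_ge0 ?vge0// addr_ge0// ltW.
  by rewrite vE// mulr_ge0_le0 ?ge0// ltW.
have kp : 0 < k z by rewrite lt_neqAle eq_sym kz.
rewrite (ger0_norm k0) in kX kY elt.
have kXY := ratio _ _ _ kp kX kY.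
have kY0 : 0 < k Y by move: kY; rewrite ltr_norml => /andP[h1 h2]; lra.
rewrite !vE// mulrCA; apply: le_trans (_ : g (X ord0 a) * ((1 + eta) * k Y) <= _).
  by rewrite ler_wpM2l ?ge0.
rewrite ler_wpM2r//; first by rewrite mulr_ge0 ?addr_ge0// ltW.
by apply: gmono; rewrite ?simplex01// XY.
Unshelve. all: by end_near.
Qed.

Variable nu : nat -> probability (borel 'rV[R]_d) R.
Hypothesis nu_inv : forall n, (0 < n)%N ->
  invariant_measure (empirical n) (glauber_generator r n) (nu n).
Variable I0 : 'rV[R]_d -> \bar R.
Hypothesis I0_LDP : LDP simplex nu I0.

Let inv n : (0 < n)%N ->
  invariant_measure (empirical n) (jump_generator (@glauber_step R d) (glauber_rho r) n) (nu n).
Proof. by move=> n0; rewrite -glauber_generatorE; exact: nu_inv. Qed.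

(** Moving a mass tau from a to b raises I0 by at most tau times a constant, as this jump has a
    positive rate at z; a small tau keeps both the displacement and the increase below gam. *)
Lemma glauber_spread_step (z : 'rV[R]_d) a b (gam : R) :
  simplex z -> active a b -> 0 < z ord0 a -> z ord0 b = 0 -> 0 < gam ->
  exists z1, [/\ simplex z1, `|z - z1| < gam, (I0 z1 <= I0 z + gam%:E)%E,
    forall i, 0 < z ord0 i -> 0 < z1 ord0 i & 0 < z1 ord0 b].
Proof.
move=> Ez ab za zb gam0.
pose w (k : 'I_d * 'I_d) : R := (k == (a, b))%:R.
have w0 k : 0 <= w k by [].
have wv k : 0 < w k -> 0 < v k.1 k.2 z.
  rewrite /w; case: eqVneq => [->|_]; last by rewrite ltxx.
  by move=> _; exact: glauber_active_gt0.
have [c c0 hc] := rate_local_le (glauber_jump_model) inv I0_LDP Ez w0 wv ltr01.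
pose e := glauber_step (a, b) : 'rV[R]_d.
have we : \sum_k w k *: glauber_step k = e.
  rewrite (bigD1 (a, b))//= /w eqxx scale1r big1 ?addr0// => k /negbTE ->.
  by rewrite scale0r.
set cost := \sum_k _ in hc.
have : \forall tau \near 0^'+, [/\ 0 < tau, tau < c, tau < z ord0 a,
    tau < gam / (`|e| + 1) & tau < gam / (`|cost + 1| + 1)].
  by near=> tau; split => //; near: tau; apply: nbhs_right_lt; rewrite ?divr_gt0// ltr_pwDr.
move=> /filter_ex[tau [tau0 tauc tauz taue taucost]].
have Ez1 : simplex (z + tau *: e) by apply: simplex_move => //; exact: ltW.
have ba : b == a = false.
  by apply/negP => /eqP ba; rewrite -ba zb ltxx in za.
exists (z + tau *: e); split=> //.
- rewrite opprD addNKr normrN normrZ gtr0_norm//.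
  move: taue; rewrite ltr_pdivlMr ?ltr_pwDr//; apply: le_lt_trans.
  by rewrite ler_pM2l// lerDl.
- have := hc tau w tau0 tauc w0 _ wv; rewrite we => /(_ _ Ez1) h.
  apply: le_trans (h _) _; first by move=> k; rewrite subrr normr0.
  rewrite leeD2l// lee_fin.
  move: taucost; rewrite ltr_pdivlMr ?ltr_pwDr// => /ltW; apply: le_trans.
  by rewrite ler_pM2l// (le_trans (ler_norm _))// lerDl.
- move=> i zi; rewrite !mxE/=; have [->|ia] := eqVneq i a.
    by rewrite eq_sym ba /=; lra.
  by case: (i == b); rewrite /=; lra.
- by rewrite !mxE !eqxx/= ba zb /= subr0 add0r mulr1.
Unshelve. all: by end_near.
Qed.
(** As long as an active jump leads from a charged state to an uncharged one, [glauber_spread_step]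
    charges the latter, at the price of half of [gam]. The recursion is on the number of uncharged
    states. *)
Lemma glauber_spread (z : 'rV[R]_d) (gam : R) : simplex z -> 0 < gam ->
  exists z1, [/\ simplex z1, `|z - z1| < gam, (I0 z1 <= I0 z + gam%:E)%E,
    forall i, 0 < z ord0 i -> 0 < z1 ord0 i &
    forall a b, active a b -> 0 < z1 ord0 a -> 0 < z1 ord0 b].
Proof.
have [n] := ubnP #|[pred i | z ord0 i == 0]|.
elim: n z gam => // n IH z gam zn Ez gam0.
have [closed|] := pselect (forall a b, active a b -> 0 < z ord0 a -> 0 < z ord0 b).
  by exists z; split=> //; [rewrite subrr normr0|rewrite leeDl// lee_fin ltW].
move=> /existsNP[a /existsNP[b /not_implyP[ab /not_implyP[za zb]]]].
have [z0 _] := Ez.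
have {}zb : z ord0 b = 0.
  by apply/eqP; rewrite eq_le z0 andbT leNgt; apply/negP.
have g20 : 0 < gam / 2 by rewrite divr_gt0.
have [z1 [Ez1 zz1 I1 supp z1b]] := glauber_spread_step Ez ab za zb g20.
have z1n : (#|[pred i | z1 ord0 i == 0%R]| < n)%N.
  rewrite -ltnS; apply: leq_trans zn; rewrite ltnS; apply: proper_card.
  apply/properP; split.
    apply/fintype.subsetP => i; rewrite !inE => /eqP z1i; apply: contraT => zi.
    have /supp : 0 < z ord0 i by rewrite lt_neqAle eq_sym zi z0.
    by rewrite z1i ltxx.
  by exists b; rewrite !inE ?zb// gt_eqF.
have [z2 [Ez2 zz2 I2 supp2 closed2]] := IH z1 (gam / 2) z1n Ez1 g20.
exists z2; split=> //.
- rewrite -(subrKA z1) [ltRHS]splitr; apply: le_lt_trans (ler_normD _ _) _.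
  by rewrite ltrD.
- apply: le_trans I2 _; rewrite [in leRHS](splitr gam) EFinD addeA leeD2r//.
- by move=> i /supp/supp2.
Qed.

Variable x : R -> 'rV[R]_d.
Hypothesis x_sol : solution simplex (drift (glauber_hamiltonian v)) x.

(** The mass that x puts on the states not charged by z1 is 0 at time s and cannot increase, since
    no active jump leads from a charged state to an uncharged one. *)
Lemma glauber_support (s u : R) (z1 : 'rV[R]_d) : 0 <= s -> s <= u -> simplex z1 ->
  (forall i, 0 < x s ord0 i -> 0 < z1 ord0 i) ->
  (forall a b, active a b -> 0 < z1 ord0 a -> 0 < z1 ord0 b) ->
  forall i, 0 < x u ord0 i -> 0 < z1 ord0 i.
Proof.
move=> s0 su [z10 _] supp closed.
have Ex t : 0 <= t -> simplex (x t) by exact: (solution_in x_sol).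
pose c (i : 'I_d) : R := (z1 ord0 i == 0)%:R.
pose m t := \sum_i c i * x t ord0 i.
have rm := right_primitive_sum (index_enum 'I_d) c (solution_coord x_sol).
have mu : m u <= m s.
  apply: (right_primitive_le rm) => // t st _.
  have Et : simplex (x t) by apply: Ex; exact: le_trans st.
  have -> : \sum_i c i * drift (glauber_hamiltonian v) (x t) ord0 i =
      \sum_k v k.1 k.2 (x t) * (c k.2 - c k.1).
    have cd (j : 'I_d) : \sum_i c i * (delta_mx ord0 j : 'rV[R]_d) ord0 i = c j.
      rewrite (bigD1 j)//= big1 => [|i ij]; first by rewrite mxE !eqxx mulr1 addr0.
      by rewrite mxE (negbTE ij) andbF mulr0.
    rewrite glauber_driftE.
    have sumE (f : 'I_d * 'I_d -> 'rV[R]_d) i : (\sum_k f k) ord0 i = \sum_k f k ord0 i.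
      exact: summxE.
    under eq_bigr do rewrite sumE mulr_sumr.
    rewrite exchange_big/=; apply: eq_bigr => k _.
    rewrite -!cd -sumrB mulr_sumr; apply: eq_bigr => i _.
    by rewrite /glauber_step !mxE; ring.
  apply: sumr_le0 => -[a b] _ /=.
  have vt : 0 <= v a b (x t) by exact: (glauber_v_ge0 rates).
  rewrite /c; have [z1b|z1b] := eqVneq (z1 ord0 b) 0; last first.
    by rewrite mulr_ge0_le0// sub0r oppr_le0.
  have [z1a|z1a] := eqVneq (z1 ord0 a) 0; first by rewrite subrr mulr0.
  have -> : v a b (x t) = 0; last by rewrite mul0r.
  apply: contrapT => vn; have ab : active a b by move=> /(_ _ Et).
  have := closed a b ab; rewrite z1b ltxx lt_neqAle eq_sym z1a z10.
  by move=> /(_ isT).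
have ms : m s = 0.
  rewrite /m big1// => i _; rewrite /c; case: eqVneq => [z1i|_]; last by rewrite mul0r.
  have [xs0 _] := Ex s s0; suff -> : x s ord0 i = 0 by rewrite mulr0.
  apply/eqP; rewrite eq_le xs0 andbT leNgt; apply/negP => /supp.
  by rewrite z1i ltxx.
move=> i xi; rewrite lt_neqAle z10 andbT; apply/negP => /eqP z1i.
have : 0 < m u.
  rewrite /m (bigD1 i)//= {1}/c -z1i eqxx mul1r ltr_pwDl// sumr_ge0// => j _.
  by rewrite mulr_ge0 ?ler0n//; have [-> _] := Ex u (le_trans s0 su).
by rewrite ltNge -ms mu.
Qed.

Let Ex t : 0 <= t -> simplex (x t).
Proof. exact: (solution_in x_sol). Qed.

Lemma solution_rate_continuous a b t eps : 0 <= t -> 0 < eps ->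
  exists2 c : R, 0 < c &
    forall u, 0 <= u -> `|t - u| < c -> `|v a b (x t) - v a b (x u)| < eps.
Proof.
move=> t0 eps0.
have cv : {within simplex, continuous (v a b)} by exact: (glauber_v_continuous rates).
have [c c0 hc] := within_continuous_norm cv (Ex t0) eps0.
have [c' c'0 hc'] := solution_continuous x_sol t0 c0.
by exists c' => // u u0 tu; apply: hc; [exact: Ex|exact: hc'].
Qed.

(** The increment of x, written by [solution_flux] with the rates along x, is performed from the
    shifted point; the last hypothesis makes every jump used possible there. Half of eta covers the
    entropy cost and half the error of a short time step. *)
Lemma glauber_shifted_step (t : R) (zeta : 'rV[R]_d) (eta : R) : 0 <= t -> 0 < eta ->
  simplex (x t + zeta) ->
  \sum_k entropy_cost (v k.1 k.2 (x t)) (v k.1 k.2 (x t + zeta)) <= eta / 2 ->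
  (forall a u, t <= u -> 0 < x u ord0 a -> 0 < (x t + zeta) ord0 a) ->
  exists2 c : R, 0 < c & forall h, 0 < h -> h < c -> simplex (x (t + h) + zeta) ->
    (I0 (x (t + h)%R + zeta)%R <= I0 (x t + zeta)%R + (eta * h)%:E)%E.
Proof.
move=> t0 eta0 EY cost pos.
pose w (k : 'I_d * 'I_d) := v k.1 k.2 (x t).
have v_pos k u : t <= u -> 0 < v k.1 k.2 (x u) -> 0 < v k.1 k.2 (x t + zeta).
  move=> tu /(glauber_v_gt0 (Ex (le_trans t0 tu)))[ab xa].
  by apply: (glauber_active_gt0 EY ab); exact: pos xa.
have w0 k : 0 <= w k by apply: (glauber_v_ge0 rates); exact: Ex.
have wv k : 0 < w k -> 0 < v k.1 k.2 (x t + zeta) by exact: v_pos.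
have e20 : 0 < eta / 2 by rewrite divr_gt0.
have [c c0 hc] := rate_local_le (glauber_jump_model) inv I0_LDP EY w0 wv e20.
have : \forall c' \near 0^'+, [/\ 0 < c', c' < c & forall k : 'I_d * 'I_d,
    forall u, 0 <= u -> `|t - u| < c' -> `|w k - v k.1 k.2 (x u)| < c].
  near=> c'; split => //.
  near: c'; apply: filter_forall => k.
  have [c1 c10 hc1] := solution_rate_continuous k.1 k.2 t0 c0.
  near=> c' => u u0 tu; apply: hc1 => //; apply: lt_trans tu _.
  by near: c'; exact: nbhs_right_lt.
move=> /filter_ex[c' [c'0 c'c hw]]; exists c' => // h h0 hc' EYh.
have v_cont (k : 'I_d * 'I_d) : {within simplex, continuous (v k.1 k.2)}.
  exact: (glauber_v_continuous rates).
have [u [tu xh]] := solution_flux x_sol v_cont (fun y _ => glauber_driftE v y) t0 h0.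
have yh : x t + zeta + h *: \sum_k v k.1 k.2 (x (u k)) *: glauber_step k =
    x (t + h) + zeta by rewrite xh addrAC.
have utk k : t <= u k by have /andP[] := tu k.
have := hc h (fun k => v k.1 k.2 (x (u k))) h0 (lt_trans hc' c'c).
rewrite yh => /(_ _ _ _ EYh) hI; apply: le_trans (hI _ _ _) _.
- by move=> k; apply: (glauber_v_ge0 rates); apply: Ex; exact: le_trans (utk k).
- move=> k; rewrite distrC; apply: hw; first exact: le_trans (utk k).
  have /andP[u1 u2] := tu k; rewrite distrC ger0_norm ?subr_ge0//; lra.
- by move=> k; exact: v_pos.
rewrite leeD2l// lee_fin mulrC ler_wpM2r ?(ltW h0)//.
by rewrite [leRHS]splitr lerD2r.
Unshelve. all: by end_near.
Qed.

Lemma glauber_decay s t : 0 <= s -> s <= t -> (I0 (x t) <= I0 (x s))%E.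
Proof.
apply: (rate_solution_le I0_LDP x_sol) => {}s eta s0 eta0.
set z := x s.
have Ez : simplex z by exact: Ex.
have [z0 z1] := Ez.
pose N : R := #|{: 'I_d * 'I_d}|.+1%:R.
have N0 : 0 < N by rewrite ltr0n.
pose C : R := \sum_(k : 'I_d * 'I_d) v k.1 k.2 z + 1.
have v0 y a b : simplex y -> 0 <= v a b y by exact: (glauber_v_ge0 rates).
have C0 : 0 < C by rewrite ltr_pwDr// sumr_ge0// => k _; exact: v0.
(* [C] will bound the rates along the path, which exceed those at z by at most iota <= 1. Each of
   the fewer than N jumps then costs at most (C + 1) * iota, in total at most eta / 2. *)
pose iota := Num.min 1 (eta / (2 * N * (C + 1))).
have iota0 : 0 < iota by rewrite lt_min ltr01 divr_gt0// !mulr_gt0// addr_gt0.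
have [c c0 hc] := glauber_v_compare Ez iota0.
(* States charged by z have mass above [rad], hence stay charged on the shifted path: following x
   and shifting each lose less than half of [rad]. *)
have : \forall rad \near 0^'+, [/\ 0 < rad, rad < c &
    forall a, z ord0 a != 0 -> rad < z ord0 a].
  near=> rad; split => //.
  near: rad; apply: filter_forall => a.
  have [->|za] := eqVneq (z ord0 a) 0; first by near=> rad.
  near=> rad => _; near: rad; apply: nbhs_right_lt.
  by rewrite lt_neqAle eq_sym za z0.
move=> /filter_ex[rad [rad0 radc radz]].
have rad20 : 0 < rad / 2 by rewrite divr_gt0.
have [h0 h00 hh0] := solution_continuous x_sol s0 rad20.
exists h0 => // h hpos hh.
have Ezh : simplex (x (s + h)) by apply: Ex; rewrite addr_ge0// ltW.
have := rate_ge0 I0_LDP Ez; case Iz : (I0 z) => [a| |]// a0; last by rewrite addye// leey.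
rewrite -EFinD leNgt; apply/negP => aI.
have [g g0 agI] : exists2 g : R, 0 < g & ((a + eta * h + g)%:E < I0 (x (s + h)%R))%E.
  move: aI; case: (I0 (x (s + h)%R)) => [b| |]//; last first.
    by exists 1 => //; rewrite ltry.
  rewrite lte_fin => ab; exists ((b - (a + eta * h)) / 2); first by rewrite divr_gt0// subr_gt0.
  by rewrite lte_fin; lra.
have [rho rho0 hrho] := rate_lsc I0_LDP Ezh agI.
(* The three bounds limit the increase of I0 from z to y, bring the end of the shifted path into the
   range of lower semi-continuity at x (s + h), and keep the shifted path close to z. *)
pose gam := Num.min g (Num.min rho (rad / 2)).
have gam0 : 0 < gam by rewrite !lt_min g0 rho0.
have [y [Ey zy Iy supp closed]] := glauber_spread Ez gam0.
have [y0 y1] := Ey.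
have gamg : gam <= g by rewrite ge_min lexx.
have gamrho : gam <= rho by rewrite !ge_min lexx orbT.
have gamrad : gam <= rad / 2 by rewrite !ge_min lexx !orbT.
pose zeta := y - z.
have zzeta a' : z ord0 a' != 0 -> zeta ord0 a' > - (rad / 2).
  move=> _; have := coord_le_norm (z - y) a'; rewrite /zeta !mxE => h1.
  have := le_lt_trans (le_trans (ler_norm _) h1) zy; lra.
have near_z u : 0 <= u -> u <= h -> `|z - x (s + u)| < rad / 2.
  move=> u0 uh; apply: hh0; first by rewrite addr_ge0.
  by rewrite opprD addrA subrr sub0r normrN ger0_norm//; exact: le_lt_trans hh.
have phi_pos u a' : 0 <= u -> u <= h -> 0 < y ord0 a' -> 0 < (x (s + u) + zeta) ord0 a'.
  move=> u0 uh ya; rewrite mxE; have [za|za] := eqVneq (z ord0 a') 0.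
    have [x0 _] := Ex (addr_ge0 s0 u0).
    by rewrite ltr_wpDl ?x0// /zeta !mxE za subr0.
  have h1 := coord_le_norm (z - x (s + u)) a'; rewrite !mxE in h1.
  have h2 := le_lt_trans (le_trans (ler_norm _) h1) (near_z u u0 uh).
  by have := zzeta a' za; have := radz a' za; lra.
have phi_in u : 0 <= u -> u <= h -> simplex (x (s + u) + zeta).
  move=> u0 uh; have [x0 x1] := Ex (addr_ge0 s0 u0); split=> [a'|].
    (* A state not charged by y is not charged by z either, so the shift vanishes there. *)
    have [ya|ya] := eqVneq (y ord0 a') 0; last first.
      by apply/ltW/phi_pos => //; rewrite lt_neqAle eq_sym ya y0.
    have za : z ord0 a' = 0.
      apply/eqP; rewrite eq_le z0 andbT leNgt; apply/negP => /supp.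
      by rewrite ya ltxx.
    by rewrite mxE /zeta !mxE ya za subrr addr0.
  under eq_bigr do rewrite mxE /zeta [(y - z) _ _]mxE [(- z) _ _]mxE.
  by rewrite big_split/= sumrB x1 y1 z1 subrr addr0.
have phi0 : x (s + 0) + zeta = y by rewrite addr0 /zeta -/z subrKC.
have : (I0 (x (s + h)%R + zeta)%R <= I0 (x (s + 0)%R + zeta)%R + (eta * h)%:E)%E.
  apply: (@rate_path_le _ _ _ _ _ I0_LDP (fun u => x (s + u) + zeta)) => //.
  - exact: ltW.
  - exact: ltW.
  - move=> u eps u0 eps0.
    have [q q0 hq] := solution_continuous x_sol (addr_ge0 s0 u0) eps0.
    exists q => // w w0 uw; rewrite opprD addrACA subrr addr0; apply: hq.
      by rewrite addr_ge0.
    by rewrite opprD addrACA subrr add0r.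
  move=> u u0 uh.
  have su0 : 0 <= s + u by rewrite addr_ge0.
  have [|||q q0 hq] := @glauber_shifted_step (s + u) zeta eta su0 eta0.
  - by apply: phi_in => //; exact: ltW.
  - apply: le_trans (_ : \sum_(k : 'I_d * 'I_d) N^-1 * (eta / 2) <= _); last first.
      rewrite sumr_const -[leLHS]mulr_natl mulrA ler_piMl ?divr_ge0 ?(ltW eta0)//.
      by rewrite ler_pdivrMr// mul1r ler_nat leqnSn.
    apply: ler_sum => -[a' b'] _ /=.
    have EX : simplex (x (s + u)) by exact: Ex.
    have EY : simplex (x (s + u) + zeta) by apply: phi_in => //; exact: ltW.
    have zX := near_z u u0 (ltW uh).
    have zY : `|z - (x (s + u) + zeta)| < c.
      apply: lt_trans radc; rewrite opprD addrA [ltRHS]splitr.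
      apply: le_lt_trans (ler_normB _ _) _; rewrite ltrD//.
      by rewrite /zeta distrC; exact: lt_le_trans zy gamrad.
    have zXc : `|z - x (s + u)| < c by apply: lt_trans radc; lra.
    have [vYX [vXz vXY]] := hc a' b' _ _ EX EY zXc zY.
    apply: le_trans (_ : (C + 1) * iota <= _).
      apply: entropy_cost_le; rewrite ?v0//; first last.
      (* Where z vanishes the shift equals y >= 0, so the shifted coordinate is the larger one, as
         the monotone factor requires. *)
      - apply: vXY => za; rewrite mxE lerDl /zeta !mxE za subr0; exact: y0.
      - exact: ltW.
      - apply: le_trans vXz _; rewrite /C lerD//; last by rewrite ge_min lexx.
        rewrite (bigD1 (a', b'))//= lerDl sumr_ge0// => k _; exact: v0.
    have C1 : 0 < C + 1 by rewrite addr_gt0.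
    rewrite mulrC -ler_pdivlMr//; apply: le_trans (_ : eta / (2 * N * (C + 1)) <= _).
      by rewrite ge_min lexx orbT.
    by rewrite le_eqVlt; apply/orP; left; apply/eqP; field; rewrite !gt_eqF.
  - move=> a' w suw xw; apply: phi_pos => //; first exact: ltW.
    apply: (@glauber_support s w y) => //.
    by apply: le_trans suw; rewrite lerDl.
  exists q => // k k0 kq ukh; rewrite [s + (u + k)]addrA; apply: hq => //.
  by rewrite -addrA; apply: phi_in => //; rewrite addr_ge0// ltW.
rewrite phi0 => hI.
(* The end of the shifted path lies within [rho] of x (s + h), where I0 exceeds this bound: a
   contradiction. *)
have : (I0 (x (s + h)%R + zeta)%R <= (a + eta * h + g)%:E)%E.
  apply: le_trans hI _; apply: (@le_trans _ _ ((a + gam)%:E + (eta * h)%:E)%E).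
    by rewrite leeD2r// EFinD -Iz.
  by rewrite -EFinD lee_fin; lra.
apply/negP; rewrite -ltNge; apply: hrho.
  by apply: phi_in => //; exact: ltW.
rewrite opprD addrA subrr sub0r normrN /zeta distrC; exact: lt_le_trans zy gamrho.
Unshelve. all: by end_near.
Qed.
End GlauberDecay.

Theorem proposition2p8 (R : realType) (d : nat) (d_gt0 : (0 < d)%N)
    (E : set 'rV[R]_d) (En : nat -> set 'rV[R]_d)
    (A : nat -> ('rV[R]_d -> R) -> 'rV[R]_d -> R)
    (H : 'rV[R]_d -> 'rV[R]_d -> R) (model : is_model E En A H)
    (nu : nat -> probability (borel 'rV[R]_d) R)
    (nu_invariant : forall n, (0 < n)%N -> invariant_measure (En n) (A n) (nu n))
    (I0 : 'rV[R]_d -> \bar R)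
    (I0_LDP : LDP E nu I0) (I0_good : good_rate E I0)
    (x : R -> 'rV[R]_d) (x_sol : solution E (drift H) x) :
  forall s t : R, 0 <= s -> s <= t -> (I0 (x t) <= I0 (x s))%E.
Proof.
case: model nu_invariant I0_LDP x_sol => [rp rm vp vm rates|r v rates] inv ldp sol s t.
  exact: (ehrenfest_decay rates sol inv ldp).
exact: (glauber_decay rates inv ldp sol).
Qed.
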